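(* Let $p$ be a prime, $c\ge 1$ an integer, and $G$ a finite $p$-group of order $p^n$. Suppose $B$ is a cyclic subgroup of the center $Z(G)$ of order $p^k$, where $p^k=\exp(Z(G))$, and suppose $A=G/B$ can be generated by $d$ elements. Then $$|\gamma_{c+1}(G)|\,|M^{(c)}(G)|\le p^{\chi_{c+1}(n-k)+dk(1+d)^{c-1}}.$$
   Context: For a group $X$, $\gamma_1(X)=X$ and $\gamma_{i+1}(X)=[\gamma_i(X),X]$ (lower central series). For subgroups $U,V$ of a group, $[U,{}_0V]=U$ and $[U,{}_{i+1}V]=[[U,{}_iV],V]$. The $c$-nilpotent multiplier of a group $G$ with free presentation $G\cong F/R$ ($F$ free) is $M^{(c)}(G)=(R\cap\gamma_{c+1}(F))/[R,{}_cF]$; it is an abelian group independent (up to isomorphism) of the presentation. $\chi_n(d)=\frac1n\sum_{m\mid n}\mu(m)d^{n/m}$ (Witt's formula, $\mu$ the Möbius function) is the number of basic commutators of weight $n$ on $d$ generators. *)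

(* Defs.v *)
From HB Require Import structures.
From mathcomp Require Import all_boot all_order all_algebra all_fingroup all_solvable.
From mathcomp Require Import center nilpotent.
Set Implicit Arguments. Unset Strict Implicit. Unset Printing Implicit Defensive.

Definition squarefree (m : nat) : bool := all (fun q => logn q m <= 1) (primes m).

Definition moebius (m : nat) : int :=
  if squarefree m then ((-1) ^+ size (primes m))%R else 0%R.

(* chi_n(d) = (1/n) * sum_{m | n} mu(m) d^(n/m)  (an integer >= 0 for n>=1) *)
Definition witt_chi (n d : nat) : nat :=
  `| ((\sum_(m <- divisors n) moebius m * (d ^ (n %/ m))%:Z)%R %/ n%:Z)%Z |%N.

(* a letter (i, false) is the generator x_i, (i, true) is x_i^-1 *)
Definition letter := (nat * bool)%type.
Definition word := seq letter.
Definition linv (x : letter) : letter := (x.1, ~~ x.2).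

Definition wpush (x : letter) (w : word) : word :=
  if w is y :: w' then (if y == linv x then w' else x :: w) else [:: x].
Definition wmul (u v : word) : word := foldr wpush v u.
Definition winv (u : word) : word := rev (map linv u).
Definition wone : word := [::].

Fixpoint reduced (w : word) : bool :=
  if w is x :: w' then
    (if w' is y :: _ then y != linv x else true) && reduced w'
  else true.

Definition freeF (r : nat) (w : word) : Prop :=
  reduced w /\ all (fun x => x.1 < r) w.

Inductive wgen (S : word -> Prop) : word -> Prop :=
  | wgen_one : wgen S wone
  | wgen_in w : S w -> wgen S w
  | wgen_inv w : wgen S w -> wgen S (winv w)
  | wgen_mul u v : wgen S u -> wgen S v -> wgen S (wmul u v).

Definition wcomm (u v : word) : word := wmul (winv u) (wmul (winv v) (wmul u v)).

Definition wcommsub (U V : word -> Prop) : word -> Prop :=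
  wgen (fun w => exists u v, U u /\ V v /\ w = wcomm u v).

Fixpoint wgamma (r i : nat) : word -> Prop :=
  match i with
  | 0 | 1 => freeF r
  | j.+1 => wcommsub (wgamma r j) (freeF r)
  end.

Fixpoint witcomm (U V : word -> Prop) (c : nat) : word -> Prop :=
  if c is c'.+1 then wcommsub (witcomm U V c') V else U.

Section Eval.
Variable gT : finGroupType.
Definition eval_letter (gens : seq gT) (x : letter) : gT :=
  let g := nth 1%g gens x.1 in if x.2 then (g^-1)%g else g.
Definition weval (gens : seq gT) (w : word) : gT :=
  (\prod_(x <- w) eval_letter gens x)%g.
End Eval.

Definition relsub (gT : finGroupType) (gens : seq gT) : word -> Prop :=
  fun w => freeF (size gens) w /\ weval gens w = 1%g.

Definition presents (gT : finGroupType) (G : {group gT}) (gens : seq gT) : Prop :=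
  {subset gens <= G} /\ <<[set x in gens]>>%g = G.

(* |A / N| = m, for subgroups N <= A of a free group:
   s is a transversal of the cosets of N in A of size m *)
Definition quot_card (A N : word -> Prop) (m : nat) : Prop :=
  exists s : seq word,
    [/\ size s = m,
        (forall w, w \in s -> A w),
        (forall i j, i < j < m -> ~ N (wmul (winv (nth wone s i)) (nth wone s j))) &
        (forall a, A a -> exists2 w, w \in s & N (wmul (winv w) a))].

Definition cmult_order (gT : finGroupType) (gens : seq gT) (c m : nat) : Prop :=
  quot_card (fun w => relsub gens w /\ wgamma (size gens) c.+1 w)
            (witcomm (relsub gens) (freeF (size gens)) c) m.

(* Main.v *)
(** Write [F] for the free group, [R] for the kernel of [F -> G], [S] for the
    preimage of [B], and [N_i = [N,_i F]].  Since [gamma_{c+1}(G)] is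
    [gamma_{c+1}(F) / (R :&: gamma_{c+1}(F))], the left hand side is the index of
    [R_c] in [gamma_{c+1}(F)], and it is bounded through the intermediate [S_c].

    If [R <= S] with [[S,F] <= R], then [S_i / R_i] is central in [F / R_i] and
    commutation induces bilinear maps between the [S_i / R_i] and the lower
    central factors of [F].  For [S = <b>R] this has two consequences.  First,
    [S_c / R_c] is generated by the commutators [[b,y_1,...,y_c]], [y_1] a lift of
    a generator of [G / B] and the other [y_i] such a lift or [b]: there are
    [d(1+d)^(c-1)] of them, of exponent dividing [|B|].  Second, the Jacobi
    identity rewrites these into bracketed Lyndon words containing [b].  Applied
    along a central series of the [p]-group [F / S] with factors of order [p], the
    second bound adds up to [p ^ L], [L] the number of Lyndon words of length
    [c+1] on [n-k] letters, and [L <= chi_{c+1}(n-k)] because the rotations of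
    Lyndon words are distinct primitive words. *)

Require Import Defs.
From HB Require Import structures.
From mathcomp Require Import all_boot all_order all_algebra all_fingroup all_solvable.
From mathcomp Require Import center nilpotent.
From mathcomp Require Import zify.
From Stdlib Require Import Classical.
Set Implicit Arguments. Unset Strict Implicit. Unset Printing Implicit Defensive.
Import Order.TTheory Order.DefaultSeqLexiOrder.

(** * Lexicographic order on words *)

Section Lex.
Implicit Types s t u v w : seq nat.

Lemma ltxi_cat2l s u v : (s ++ u < s ++ v)%O = (u < v)%O.
Proof. by elim: s => //= x s <-; rewrite eqhead_ltxiE. Qed.

Lemma ltxi_catr s u : u != [::] -> (s < s ++ u)%O.
Proof. by move=> un; rewrite -{1}[s]cats0 ltxi_cat2l ltxi0s. Qed.

Lemma lexi_catr s u : (s <= s ++ u)%O.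
Proof. by case: u => [|x u]; rewrite ?cats0 // ltW // ltxi_catr. Qed.

(** Either the order is decided at a first differing letter, and appending letters cannot change it,
    or [u] is a proper prefix of [v]. *)
Lemma ltxi_split u v : (u < v)%O ->
  (exists2 s, s != [::] & v = u ++ s) \/ (forall a b, (u ++ a < v ++ b)%O).
Proof.
elim: u v => [|x u IH] [|y v] //; first by left; exists (y :: v).
have [<-|xy] := eqVneq x y.
  rewrite eqhead_ltxiE => /IH[[s sn ->]|H]; first by left; exists s.
  by right=> a b; rewrite !cat_cons eqhead_ltxiE.
by rewrite neqhead_ltxiE // => lxy; right=> a b;
  rewrite !cat_cons neqhead_ltxiE.
Qed.

Lemma ltxi_cat_size u v a b :
  (u < v)%O -> size v <= size u -> (u ++ a < v ++ b)%O.
Proof.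
by move=> /ltxi_split[[s + ->]|//]; rewrite size_cat; case: s => //= ? ?; lia.
Qed.

(** The base [D] value of a word turns the lexicographic order on words of equal
    length into a measure that well-founded induction can use. *)
Definition digits D w := foldl (fun a x => a * D + x) 0 w.

Lemma digits_cons D x w : digits D (x :: w) = x * D ^ size w + digits D w.
Proof.
rewrite /digits /= mul0n add0n.
suff H a : foldl (fun a x => a * D + x) a w
   = a * D ^ size w + foldl (fun a x => a * D + x) 0 w by apply: H.
elim: w a => [|y w IH] a /=; first by rewrite muln1 addn0.
by rewrite IH (IH (0 * D + y)) mulnDl expnS -mulnA mul0n add0n addnA.
Qed.

Lemma digits_bound D w : all (fun x => x < D) w -> digits D w < D ^ size w.
Proof.
elim: w => [|x w IH] //= /andP[xD /IH wD]; rewrite digits_cons expnS.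
have : x.+1 * D ^ size w <= D * D ^ size w by rewrite leq_mul2r xD orbT.
by rewrite mulSn; lia.
Qed.

Lemma ltxi_digits D u v : size u = size v ->
  all (fun x => x < D) u -> all (fun x => x < D) v ->
  (u < v)%O -> digits D u < digits D v.
Proof.
elim: u v => [|x u IH] [|y v] //= [suv] /andP[xD uD] /andP[yD vD].
rewrite !digits_cons suv.
have [<-|xy] := eqVneq x y.
  by rewrite eqhead_ltxiE ltn_add2l; apply: IH.
rewrite neqhead_ltxiE // => lxy; have {}lxy : (x < y)%N := lxy.
have := digits_bound uD; rewrite suv.
have : x.+1 * D ^ size v <= y * D ^ size v by rewrite leq_mul2r lxy orbT.
by rewrite mulSn; lia.
Qed.

End Lex.

(** * Lyndon words and their standard factorization *)

Section Lyndon.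
Implicit Types s t u v w : seq nat.

Definition lyndon w :=
  (w != [::]) && all (fun i => (w < drop i w)%O) (iota 1 (size w).-1).

Lemma lyndonP w : reflect
  (w <> [::] /\ forall u v, u <> [::] -> v <> [::] -> w = u ++ v -> (w < v)%O)
  (lyndon w).
Proof.
apply: (iffP andP) => [[/eqP wn /allP H]|[/eqP wn H]]; split => //.
  move=> [|x u] [|y v] // _ _ E.
  have := H (size u).+1; rewrite {3}E drop_size_cat //; apply.
  by rewrite mem_iota E size_cat /=; lia.
apply/allP => i; rewrite mem_iota => iw.
apply: (H (take i w)); last by rewrite cat_take_drop.
  by case: w wn i iw {H} => // x w _ [|i].
by move=> /(congr1 size); rewrite size_drop /=; lia.
Qed.

Lemma lyndon_neq0 w : lyndon w -> w <> [::].
Proof. by case/lyndonP. Qed.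

Lemma lyndon_suffix u v : lyndon (u ++ v) -> u <> [::] -> v <> [::] ->
  (u ++ v < v)%O.
Proof. by case/lyndonP => _ H un vn; apply: (H u). Qed.

Fixpoint minsuffix w :=
  if w is x :: s then
    if s is [::] then w else
    let m := minsuffix s in if (w < m)%O then w else m
  else [::].

Lemma minsuffix_suffix w : exists u, w = u ++ minsuffix w.
Proof.
elim: w => [|x [|y w] [u E]]; try by exists [::].
by rewrite [minsuffix _]/=; case: ifP => _; [exists [::] | exists (x :: u); rewrite /= {1}E].
Qed.

Lemma minsuffix_neq0 w : w <> [::] -> minsuffix w <> [::].
Proof.
by elim: w => [|x [|y w] IH] // _; rewrite [minsuffix _]/=; case: ifP => // _; apply: IH.
Qed.

Lemma minsuffix_le w u v : w = u ++ v -> v <> [::] -> (minsuffix w <= v)%O.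
Proof.
elim: w u v => [|x w IH] [|z u] v //=.
  by move=> <- _; case: w {IH} => // y w; case: ltP.
case: w IH => [|y w] IH [_ E] vn.
  by case: u v E vn {IH} => [|? ?] [].
have := IH _ _ E vn; case: ifP => // /ltW; exact: le_trans.
Qed.

(** The standard factorization of a Lyndon word, its right factor being taken as
    the smallest proper suffix rather than as the longest proper Lyndon suffix. *)
Definition rfactor w := minsuffix (behead w).
Definition lfactor w := take (size w - size (rfactor w)) w.

Lemma factor_cat w : lfactor w ++ rfactor w = w.
Proof.
rewrite /lfactor /rfactor; case: w => // x w; rewrite [behead _]/=.
have [u E] := minsuffix_suffix w.
move: (minsuffix w) E => m ->.
by rewrite -cat_cons size_cat addnK take_size_cat.
Qed.

Lemma factor_unique u v : u <> [::] -> v <> [::] ->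
  (forall u' v', u' <> [::] -> v' <> [::] -> u ++ v = u' ++ v' -> (v <= v')%O) ->
  lfactor (u ++ v) = u /\ rfactor (u ++ v) = v.
Proof.
move=> un vn H.
have E : rfactor (u ++ v) = v.
  rewrite /rfactor; case: u un H => //= x u _ H.
  apply: le_anti; rewrite (@minsuffix_le _ u) //=.
  have [t E] := minsuffix_suffix (u ++ v).
  apply: (H (x :: t)) => //; last by rewrite cat_cons -E.
  by apply: minsuffix_neq0; case: (u) vn; case: (v).
by split=> //; rewrite /lfactor E size_cat addnK take_size_cat.
Qed.

Lemma rfactor_min w u v : u <> [::] -> v <> [::] -> w = u ++ v ->
  (rfactor w <= v)%O.
Proof.
rewrite /rfactor; case: u => // x u _ vn ->; exact: minsuffix_le vn.
Qed.

Lemma factor_neq0 w : 1 < size w -> lfactor w <> [::] /\ rfactor w <> [::].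
Proof.
case: w => // x w sw.
have rn : rfactor (x :: w) <> [::] by apply: minsuffix_neq0; case: w sw.
split=> // E; have := factor_cat (x :: w); rewrite E /= => E'.
have [u /(congr1 size)] := minsuffix_suffix w; rewrite size_cat.
move: E'; rewrite /rfactor /= => ->; rewrite /=; lia.
Qed.

Section Factors.
Variable w : seq nat.
Hypotheses (wL : lyndon w) (w_gt1 : 1 < size w).
Let u := lfactor w.
Let v := rfactor w.
Let wE : u ++ v = w. Proof. exact: factor_cat. Qed.
Let un : u <> [::]. Proof. by case: (factor_neq0 w_gt1). Qed.
Let vn : v <> [::]. Proof. by case: (factor_neq0 w_gt1). Qed.

(** Each proper suffix of [v] is also a proper suffix of [w], so minimality of [v] gives the
    inequality, and the lengths make it strict. *)
Lemma rfactor_lyndon : lyndon v.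
Proof.
apply/lyndonP; split=> // a b an bn E.
rewrite lt_neqAle (@rfactor_min w (u ++ a)) ?andbT //.
- apply/eqP=> Eb; move: (congr1 size E); rewrite -Eb size_cat.
  by case: a an {E} => //=; lia.
- by case: (u) un.
- by rewrite -wE E catA.
Qed.

(** Suppose a proper suffix [b] of [u] were smaller than [u]. If [u = bs], cancelling [b] in
    [uv < bv] gives [sv < v], against the minimality of [v]; if they differ at a letter, then
    [bv < uv], against [w] being Lyndon. *)
Lemma lfactor_lyndon : lyndon u.
Proof.
apply/lyndonP; split=> // a b an bn E.
have H : (u ++ v < b ++ v)%O.
  rewrite wE; move: wL; rewrite -wE E -catA => /lyndon_suffix; apply=> //.
  by case: (b) bn.
case: (ltgtP u b) => // [/ltxi_split[[s /eqP sn Es]|/(_ v v)]|Eb].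
- move: H; rewrite Es -catA ltxi_cat2l => H.
  have : (v <= s ++ v)%O.
    by apply: (@rfactor_min _ b) => //; [case: (s) sn | rewrite catA -Es wE].
  by rewrite leNgt H.
- by rewrite ltNge ltW.
- by move: (congr1 size E); rewrite Eb size_cat; case: (a) an => //=; lia.
Qed.

Lemma lfactor_lt : (u < v)%O.
Proof.
have := wL; rewrite -wE => /lyndon_suffix /(_ un vn).
by apply: le_lt_trans; apply: lexi_catr.
Qed.
End Factors.

Lemma cat_eq_cat (T : Type) (u v a b : seq T) : u ++ v = a ++ b ->
  (exists t : seq T, a = u ++ t /\ v = t ++ b) \/
  (exists2 t : seq T, t <> [::] & u = a ++ t /\ b = t ++ v).
Proof.
elim: u a => [|x u IH] [|y a] /=.
- by move=> ->; left; exists [::].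
- by move=> ->; left; exists (y :: a).
- by move=> <-; right; exists (x :: u).
move=> [-> /IH[[t [-> ->]]|[t tn [-> ->]]]]; first by left; exists t.
by right; exists t.
Qed.

(** First [uv < v], which settles the suffixes of [v]. Any other suffix is [tv] with [t] a proper
    suffix of [u]; then [u < t] and [t] is not longer than [u], so the comparison survives
    appending. *)
Lemma lyndon_cat u v : lyndon u -> lyndon v -> (u < v)%O -> lyndon (u ++ v).
Proof.
move=> /lyndonP[un uL] /lyndonP[vn vL] uv.
have uvv : (u ++ v < v)%O.
  have [[s /eqP sn E]|/(_ v [::])] := ltxi_split uv; last by rewrite cats0.
  by rewrite {2}E ltxi_cat2l (vL u).
apply/lyndonP; split=> [|a b an bn /cat_eq_cat[[t [Ea Ev]]|[t tn [Eu Eb]]]].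
- by case: (u) un.
- case: t Ea Ev => [|x t] Ea Ev; first by rewrite -[b]/([::] ++ b) -Ev.
  by apply: lt_trans uvv _; apply: (vL (x :: t)).
- rewrite Eb; apply: ltxi_cat_size; first exact: (uL a).
  by rewrite Eu size_cat leq_addl.
Qed.

(** A proper suffix longer than [v] is [tv] with [t] a proper suffix of [u], and
    [tv >= t >= rfactor u >= v]; if [u] is a single letter there is none. *)
Lemma factor_cat_lyndon u v : lyndon u -> lyndon v ->
  size u <= 1 \/ (v <= rfactor u)%O ->
  lfactor (u ++ v) = u /\ rfactor (u ++ v) = v.
Proof.
move=> uL vL H; have un := lyndon_neq0 uL; have vn := lyndon_neq0 vL.
apply: factor_unique => // a b an bn /cat_eq_cat[[t [Ea Ev]]|[t tn [Eu Eb]]].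
  case: t Ea Ev => [|x t] _ Ev; first by rewrite Ev.
  by apply: ltW; rewrite Ev; apply: lyndon_suffix; rewrite -?Ev.
case: H => [|vr].
  by rewrite Eu size_cat; case: a an {Eu} => //; case: t tn {Eb} => //= *; lia.
rewrite Eb; apply: le_trans (lexi_catr t v).
exact: le_trans vr (rfactor_min an tn Eu).
Qed.
End Lyndon.

(** * The Möbius function *)

Section Moebius.

Lemma moebiusMp q m : prime q -> 0 < m -> ~~ (q %| m) ->
  moebius (q * m) = (- moebius m)%R.
Proof.
move=> qP m0 qm; have q0 := prime_gt0 qP.
have qNm : q \notin primes m by rewrite mem_primes (negPf qm) !andbF.
have perm_qm : perm_eq (primes (q * m)) (q :: primes m).
  apply: uniq_perm; rewrite /= ?primes_uniq ?qNm // => r.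
  by rewrite primesM // primes_prime // !inE.
rewrite /moebius /squarefree (perm_all _ perm_qm) (perm_size perm_qm) /=.
rewrite lognM // logn_prime // eqxx lognE (negPf qm) !andbF addn0 /=.
have -> : all (fun r => logn r (q * m) <= 1) (primes m) =
          all (fun r => logn r m <= 1) (primes m).
  apply: eq_in_all => r rm; rewrite lognM // logn_prime //.
  by case: eqP rm qNm => [-> -> |].
by case: ifP; rewrite ?GRing.oppr0 // GRing.exprS GRing.mulN1r.
Qed.

Lemma moebius_sq q m : prime q -> 0 < m -> q ^ 2 %| m -> moebius m = 0%R.
Proof.
move=> qP m0 q2m; rewrite /moebius /squarefree ifN //; apply/allPn; exists q.
  by rewrite mem_primes qP m0 (dvdn_trans _ q2m) // expnS dvdn_mulr.
by rewrite -ltnNge -pfactor_dvdn.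
Qed.

(** For a prime [q] dividing [N > 1], the divisors divisible by [q^2] contribute 0, and the others
    cancel in pairs [m], [qm] with [q] not dividing [m]. *)
Lemma sum_moebius N : 0 < N ->
  (\sum_(m <- divisors N) moebius m)%R = Posz (N == 1).
Proof.
move=> N0; have [->|N1] := eqVneq N 1; first by rewrite big_seq1.
have qP : prime (pdiv N) by apply: pdiv_prime; lia.
set q := pdiv N in qP *; have q0 := prime_gt0 qP.
rewrite (bigID (fun m => q %| m)) /= [X in (X + _)%R](bigID (fun m => q ^ 2 %| m)) /=.
rewrite big_seq_cond big1 ?GRing.add0r; last first.
  move=> m /and3P[]; rewrite -dvdn_divisors // => mN _ q2m.
  by apply: moebius_sq qP _ q2m; apply: dvdn_gt0 mN.
have perm_q : perm_eq
    [seq m <- divisors N | (q %| m) && ~~ (q ^ 2 %| m)]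
    [seq q * m | m <- [seq m <- divisors N | ~~ (q %| m)]].
  apply: uniq_perm; first by rewrite filter_uniq ?divisors_uniq.
    rewrite map_inj_uniq ?filter_uniq ?divisors_uniq // => x y /eqP.
    by rewrite eqn_pmul2l // => /eqP.
  move=> m; rewrite mem_filter -dvdn_divisors //; apply/andP/mapP.
    move=> [/andP[/dvdnP[k ->]]]; rewrite mulnC expnS expn1 dvdn_pmul2l // => qk kN.
    exists k => //; rewrite mem_filter qk -dvdn_divisors //.
    exact: dvdn_trans (dvdn_mull _ _) kN.
  move=> [k]; rewrite mem_filter -dvdn_divisors // => /andP[qk kN] ->.
  rewrite dvdn_mulr // expnS expn1 dvdn_pmul2l // qk Gauss_dvd ?pdiv_dvd //.
  by rewrite prime_coprime.
rewrite -[X in (X + _)%R]big_filter (perm_big _ perm_q) /=.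
rewrite big_map -[X in (_ + X)%R]big_filter -big_split /= big_seq big1 // => m.
rewrite mem_filter -dvdn_divisors // => /andP[qm mN].
by rewrite moebiusMp ?GRing.addNr //; apply: dvdn_gt0 mN.
Qed.

End Moebius.

(** [burnside_app] shadows [seq.rot]. *)
Local Notation rot := seq.rot.

(** * Counting primitive words and Lyndon words *)

Section Words.
Implicit Types w v : seq nat.

Definition words n d : seq (seq nat) := [seq map val t | t : n.-tuple 'I_d].

Lemma mem_words n d w :
  (w \in words n d) = (size w == n) && all (fun x => x < d) w.
Proof.
apply/mapP/andP => [[t _ ->]|[/eqP sw wd]].
  rewrite size_map size_tuple; split=> //.
  by apply/allP => _ /mapP[i _ ->]; apply: ltn_ord.
have sz : size (pmap (insub : nat -> option 'I_d) w) == n.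
  rewrite size_pmap_sub -sw -all_count; apply: sub_all wd => x.
  by rewrite /= .
exists (Tuple sz); first by rewrite mem_enum.
rewrite /= pmap_filter; last by move=> x; rewrite /=; case: insubP.
by apply/esym/all_filterP; apply: sub_all wd => x xd; rewrite /= insubT.
Qed.

Lemma words_uniq n d : uniq (words n d).
Proof.
rewrite map_inj_uniq ?enum_uniq // => s t /inj_map E.
exact/val_inj/E/val_inj.
Qed.

Lemma size_words n d : size (words n d) = d ^ n.
Proof. by rewrite size_map -cardE card_tuple card_ord. Qed.

Lemma rot_iter i w : i <= size w -> rot i w = iter i (rot 1) w.
Proof. by elim: i => [|i IH] iw; rewrite ?rot0 // rotS //= IH // ltnW. Qed.

Lemma iter_rot_words i w n d :
  (iter i (rot 1) w \in words n d) = (w \in words n d).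
Proof.
elim: i => //= i; rewrite !mem_words size_rot => <-; congr (_ && _).
by apply: eq_all_r => x; rewrite mem_rot.
Qed.

(** Such a word is the periodic extension [g] of its first [t] letters, so [g] is a bijection from
    the words of length [t]. *)
Lemma count_rot_fixed n d t : 0 < n -> t %| n ->
  count (fun w => iter t (rot 1) w == w) (words n d) = d ^ t.
Proof.
move=> n0 tn; have t0 := dvdn_gt0 n0 tn; have le_tn := dvdn_leq n0 tn.
pose g v := mkseq (fun i => nth 0 v (i %% t)) n.
have take_g v : size v = t -> take t (g v) = v.
  move=> sv; apply: (@eq_from_nth _ 0).
    by rewrite size_takel ?size_mkseq.
  move=> i; rewrite size_takel ?size_mkseq // => it.
  by rewrite nth_take // nth_mkseq ?modn_small //; apply: leq_trans le_tn.
rewrite -size_filter -(size_words t) -[RHS](size_map g); apply/perm_size/uniq_perm.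
- by rewrite filter_uniq ?words_uniq.
- rewrite map_inj_in_uniq ?words_uniq // => u v.
  by rewrite !mem_words => /andP[/eqP su _] /andP[/eqP sv _] E;
    rewrite -(take_g u) // E take_g.
move=> w; rewrite mem_filter; apply/andP/mapP.
  move=> []; rewrite mem_words => /eqP + /andP[/eqP sw wd].
  rewrite -rot_iter ?sw // => E.
  exists (take t w).
    rewrite mem_words size_takel ?sw // eqxx /=.
    by apply/allP => x /mem_take; apply: (allP wd).
  apply: (@eq_from_nth _ 0); rewrite ?size_mkseq // sw => i.
  elim: i {-2}i (leqnn i) => [|k IH] i ik iw; rewrite nth_mkseq //.
    by rewrite nth_take ?ltn_mod // modn_small //; lia.
  case: (ltnP i t) => it; first by rewrite modn_small // nth_take.
  have -> : i %% t = (i - t) %% t by rewrite -{1}(subnK it) modnDr.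
  have := IH (i - t); rewrite nth_mkseq; last lia.
  move=> <-; [|lia|lia].
  rewrite -{2}E /rot nth_cat size_drop sw ifT; last lia.
  by rewrite nth_drop subnKC.
move=> [v]; rewrite !mem_words => /andP[/eqP sv /allP vd] ->.
rewrite size_mkseq eqxx /=; split; last first.
  by apply/allP => x /mapP[i _ ->]; apply/vd/mem_nth; rewrite sv ltn_mod.
rewrite -rot_iter ?size_mkseq //; apply/eqP/(@eq_from_nth _ 0).
  by rewrite size_rot.
rewrite size_rot size_mkseq => i iw.
rewrite /rot nth_cat size_drop size_mkseq; case: ltnP => it.
  by rewrite nth_drop !nth_mkseq ?modnDl //; lia.
rewrite nth_take ?nth_mkseq; try lia; congr nth.
have /dvdnP[k Ek] : t %| n - t by rewrite dvdn_subr.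
by rewrite -{2}(subnK it) Ek addnC modnMDl.
Qed.

Definition primitive_word w :=
  all (fun i => iter i (rot 1) w != w) (iota 1 (size w).-1).

Lemma iter_rot_size w : iter (size w) (rot 1) w = w.
Proof. by rewrite -rot_iter // rot_size. Qed.

Lemma rot_period w : w <> [::] -> exists2 e, 0 < e &
  forall i, (iter i (rot 1) w == w) = (e %| i).
Proof.
move=> wn; have ex : exists e, (0 < e) && (iter e (rot 1) w == w).
  by exists (size w); rewrite iter_rot_size eqxx andbT; case: w wn.
case: (ex_minnP ex) => e /andP[e0 /eqP Ee] emin; exists e => // i.
have Em k : iter (k * e) (rot 1) w = w.
  by elim: k => //= k IH; rewrite mulSn iterD IH.
rewrite {1}(divn_eq i e) addnC iterD Em.
have [j0|j0] := posnP (i %% e); first by rewrite /dvdn j0 /= !eqxx.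
rewrite /dvdn eqn0Ngt j0; apply/negP => /eqP/eqP Ej.
by have := emin (i %% e); rewrite j0 Ej leqNgt ltn_mod e0 => /(_ isT).
Qed.

(** Write [d^(n/m)] as the number of words fixed by rotation through [n/m] and exchange the sums. A
    word of least period [e] collects [mu(m)] over the [m] dividing [n/e], which is 1 if [e = n],
    that is, if the word is primitive, and 0 otherwise. *)
Lemma sum_moebius_primitive n d : 0 < n ->
  (\sum_(m <- divisors n) moebius m * Posz (d ^ (n %/ m)))%R =
  Posz (count primitive_word (words n d)).
Proof.
move=> n0.
transitivity (\sum_(m <- divisors n) \sum_(w <- words n d)
    moebius m * Posz (iter (n %/ m) (rot 1) w == w))%R.
  rewrite [LHS]big_seq [RHS]big_seq; apply: eq_bigr => m.
  rewrite -dvdn_divisors // => mn.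
  rewrite -GRing.mulr_sumr; congr (_ * _)%R.
  rewrite -(count_rot_fixed d n0 (dvdn_div mn)) -sum1_count big_mkcond /=.
  by rewrite (big_morph Posz PoszD (erefl _)); apply: eq_bigr => w _; case: eqP.
rewrite exchange_big /= -sum1_count [in RHS]big_mkcond (big_morph Posz PoszD (erefl _)) /=.
rewrite [LHS]big_seq [RHS]big_seq; apply: eq_bigr => w.
rewrite mem_words => /andP[/eqP sw _].
have wn : w <> [::] by move=> w0; rewrite w0 in sw; rewrite -sw in n0.
have [e e0 He] := rot_period wn.
have en : e %| n by rewrite -He -sw iter_rot_size.
transitivity (\sum_(m <- divisors (n %/ e)%N) moebius m)%R.
  transitivity (\sum_(m <- divisors n | (e %| n %/ m)%N) moebius m)%R.
    rewrite [RHS]big_mkcond; apply: eq_bigr => m _; rewrite He.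
    by case: ifP; rewrite ?GRing.mulr1 ?GRing.mulr0.
  rewrite -big_filter; apply: perm_big; apply: uniq_perm.
  - by rewrite filter_uniq ?divisors_uniq.
  - exact: divisors_uniq.
  move=> m; rewrite mem_filter -!dvdn_divisors //; last first.
    by rewrite divn_gt0 // dvdn_leq.
  apply/andP/idP => [[em mn]|me].
    by rewrite dvdn_divRL // -(divnK mn) mulnC dvdn_mul.
  have mn : m %| n by apply: dvdn_trans me _; apply: dvdn_div.
  split=> //; rewrite dvdn_divRL //.
  by move: me; rewrite dvdn_divRL // mulnC.
rewrite sum_moebius; last by rewrite divn_gt0 // dvdn_leq.
have -> : (n %/ e == 1) = (e == n).
  by apply/eqP/eqP => [E|->]; [rewrite -(divnK en) E mul1n | rewrite divnn n0].
suff -> : primitive_word w = (e == n) by case: (e == n).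
apply/allP/eqP => [H|En i].
  apply/eqP; rewrite eqn_leq dvdn_leq //= leqNgt; apply/negP => lt_en.
  have := H e; rewrite mem_iota He dvdnn sw => /(_ _)/negP; apply=> //; lia.
by rewrite mem_iota He sw En => ?; rewrite gtnNdvd //; lia.
Qed.

Definition lyndon_words n d := [seq w <- words n d | lyndon w].

Lemma lyndon_rot w i : lyndon w -> 0 < i < size w -> (w < rot i w)%O.
Proof.
move=> /lyndonP[_ H] /andP[i0 iw]; rewrite -[X in (X < _)%O]cats0.
apply: ltxi_cat_size; last by rewrite size_drop leq_subr.
apply: (H (take i w)); last by rewrite cat_take_drop.
  by case: w i i0 iw {H} => // x w [].
by move=> /(congr1 size); rewrite size_drop /=; lia.
Qed.

Lemma lyndon_iter_rot u k : lyndon u ->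
  (u < iter k (rot 1) u)%O || (size u %| k).
Proof.
move=> uL; have un := lyndon_neq0 uL.
have -> : iter k (rot 1) u = rot (k %% size u) u.
  have Eq q : iter (q * size u) (rot 1) u = u.
    by elim: q => //= q IH; rewrite mulSn iterD IH iter_rot_size.
  rewrite {1}(divn_eq k (size u)) addnC iterD Eq -rot_iter //.
  by apply: ltnW; rewrite ltn_mod; case: u {uL Eq} un.
rewrite /dvdn; have [->|k0] := posnP (k %% size u); first by rewrite orbT.
by rewrite lyndon_rot // k0 ltn_mod; case: u un {uL k0}.
Qed.

(** Each word is a rotation of the other. A Lyndon word is strictly below its nontrivial rotations,
    so one of these two rotations is trivial, which forces [i = j]. *)
Lemma lyndon_rot_inj u v i j : lyndon u -> lyndon v -> size u = size v ->
  i < size u -> j < size u -> rot i u = rot j v -> u = v /\ i = j.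
Proof.
move=> uL vL suv iu ju; rewrite !rot_iter -?suv ?(ltnW iu) ?(ltnW ju) // => E.
have Eu : u = iter (size u - i + j) (rot 1) v.
  by rewrite iterD -E -iterD subnK ?iter_rot_size // ltnW.
have Ev : v = iter (size u - j + i) (rot 1) u.
  by rewrite iterD E -iterD subnK ?suv ?iter_rot_size // -suv ltnW.
(* [n - k + l] lies strictly between [0] and [2n], so as a multiple of [n] it can only be [n]. *)
have dvd_eq k l n : k < n -> l < n -> n %| n - k + l -> k = l.
  by move=> kn ln /dvdnP[[|[|q]]]; lia.
have Eij : i = j.
  have := lyndon_iter_rot (size u - j + i) uL.
  have := lyndon_iter_rot (size v - i + j) vL.
  rewrite -{1}suv -Eu -Ev; case: ltgtP => [_ _|_|_ _] /= /dvd_eq; last first.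
  - by move=> ->.
  - by move=> ->; rewrite -?suv.
  - by move=> ->; rewrite -?suv.
by split=> //; rewrite Ev Eij subnK ?iter_rot_size // ltnW.
Qed.

Lemma lyndon_words_primitive n d : 0 < n ->
  n * size (lyndon_words n d) <= count primitive_word (words n d).
Proof.
move=> n0; rewrite -size_filter mulnC -[X in _ * X](size_iota 0) -(size_allpairs (fun w i => rot i w)).
apply: uniq_leq_size.
  apply: allpairs_uniq; rewrite ?filter_uniq ?words_uniq ?iota_uniq //.
  move=> _ _ /allpairsP[[u i] /= [+ + ->]] /allpairsP[[v j] /= [+ + ->]] /=.
  rewrite !mem_filter !mem_words !mem_iota.
  move=> /andP[uL /andP[/eqP su _]] /= iu /andP[vL /andP[/eqP sv _]] jv.
  by move=> /lyndon_rot_inj[]//; rewrite ?su // => -> ->.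
move=> _ /allpairsP[[w i] /= [+ + ->]]; rewrite !mem_filter mem_iota.
move=> /andP[wL wW]; have := wW; rewrite mem_words => /andP[/eqP sw _] /= iw.
rewrite rot_iter ?sw 1?ltnW // iter_rot_words wW andbT.
apply/allP => j; rewrite mem_iota.
have -> : size (iter i (rot 1) w) = n.
  by elim: (i) => //= k; rewrite size_rot.
move=> jn; apply/negP => /eqP; rewrite -iterD addnC iterD => E.
have {}E : iter j (rot 1) w = w.
  by elim: (i) E => //= k IH /rot_inj/IH.
have := lyndon_iter_rot j wL; rewrite E ltxx sw gtnNdvd //; lia.
Qed.

(** [chi_n(d)] is the number of primitive words divided by [n], and each Lyndon word accounts for
    [n] of them. *)
Lemma lyndon_words_witt n d : 0 < n -> size (lyndon_words n d) <= witt_chi n d.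
Proof.
move=> n0; rewrite /witt_chi sum_moebius_primitive // divz_nat /=.
by rewrite leq_divRL // mulnC lyndon_words_primitive.
Qed.
End Words.

(** * Commutator calculus for subgroups given as predicates *)

Section Subgroups.
Variable T : groupType.
Implicit Types (x y z : T) (K N R S U V E Y : T -> Prop).
Local Open Scope group_scope.

(** Only members of [S] are inverted, which spares inductions the inverse of a product;
    [gen_subgroup] recovers closure under inversion. *)
Inductive gen S : T -> Prop :=
  | gen_one : gen S 1
  | gen_in x : S x -> gen S x
  | gen_inv x : S x -> gen S x^-1
  | gen_mul x y : gen S x -> gen S y -> gen S (x * y).

Definition subgroup U :=
  [/\ U 1, forall x, U x -> U x^-1 & forall x y, U x -> U y -> U (x * y)].

Definition normalsub U := subgroup U /\ forall x z, U x -> U (x ^ z).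

Definition full : T -> Prop := fun=> True.

Definition comms U V := gen (fun w => exists u v, U u /\ V v /\ w = [~ u, v]).

(** This is [[U,_c T]]; the lower central term [gamma_{c+1}] is [icomm full c], with the index
    shifted by one. *)
Fixpoint icomm U c := if c is c'.+1 then comms (icomm U c') full else U.

Lemma gen_subgroup S : subgroup (gen S).
Proof.
split; [exact: gen_one | | exact: gen_mul].
move=> x; elim=> [|y Sy|y Sy|y z _ IHy _ IHz].
- by rewrite invg1; apply: gen_one.
- exact: gen_inv.
- by rewrite invgK; apply: gen_in.
- by rewrite invgM; apply: gen_mul.
Qed.

Lemma gen_min S K : subgroup K -> (forall x, S x -> K x) ->
  forall x, gen S x -> K x.
Proof.
move=> [K1 KV KM] SK x; elim=> [|y /SK|y /SK/KV|y z _ Ky _ Kz] //.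
exact: KM.
Qed.

Lemma gen_mono S U : (forall x, S x -> U x) -> forall x, gen S x -> gen U x.
Proof. by move=> SU; apply: gen_min (gen_subgroup U) _ => x /SU/gen_in. Qed.

Lemma normalsub_full : normalsub full.
Proof. by split. Qed.

Lemma normalsub_comm K x y : normalsub K -> K x -> K [~ x, y].
Proof. by move=> [[_ KV KM] KJ] Kx; rewrite commgEl; apply: KM; auto. Qed.

Lemma subgroupR K x y : subgroup K -> K [~ x, y] -> K [~ y, x].
Proof. by move=> [_ KV _] /KV; rewrite invgR. Qed.

Lemma comms_normal U V : normalsub U -> normalsub V -> normalsub (comms U V).
Proof.
move=> [_ UJ] [_ VJ]; split; first exact: gen_subgroup.
move=> x z; elim=> [|_ [u [v [Uu [Vv ->]]]]|_ [u [v [Uu [Vv ->]]]]|y y' _ IH _ IH'].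
- by rewrite conj1g; apply: gen_one.
- by rewrite conjRg; apply: gen_in; exists (u ^ z), (v ^ z); auto.
- by rewrite conjVg conjRg; apply: gen_inv; exists (u ^ z), (v ^ z); auto.
- by rewrite conjMg; apply: gen_mul.
Qed.

Lemma icomm_normal U c : normalsub U -> normalsub (icomm U c).
Proof.
by move=> nU; elim: c => //= c IH; apply: comms_normal => //; apply: normalsub_full.
Qed.

Lemma icommS U c x y : icomm U c x -> icomm U c.+1 [~ x, y].
Proof. by move=> Ux; apply: gen_in; exists x, y. Qed.

Lemma icommS_min U c K : subgroup K ->
  (forall x y, icomm U c x -> K [~ x, y]) -> forall x, icomm U c.+1 x -> K x.
Proof. by move=> sK H; apply: gen_min => // _ [u [v [Uu [_ ->]]]]; apply: H. Qed.

Lemma icomm_mono U V c : (forall x, U x -> V x) ->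
  forall x, icomm U c x -> icomm V c x.
Proof.
move=> UV; elim: c => //= c IH; apply: gen_mono => _ [u [v [Uu [_ ->]]]].
by exists u, v; split; [apply: IH|].
Qed.

Lemma icomm_comms U c : icomm (comms U full) c = icomm U c.+1.
Proof. by elim: c => //= c ->. Qed.

Lemma icomm_sub U c : normalsub U -> forall x, icomm U c.+1 x -> icomm U c x.
Proof.
move=> nU; apply: icommS_min; first by case: (icomm_normal c nU).
by move=> x y Ux; apply: normalsub_comm => //; apply: icomm_normal.
Qed.

(** With [U = S] and [V = R] this puts [S_{c+1}] inside [R_c], so that [S_c / R_c] is central: the
    source of the bilinearity used below. *)
Lemma icomm_absorb U V c : (forall x y, U x -> V [~ x, y]) -> normalsub V ->
  forall x, icomm U c.+1 x -> icomm V c x.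
Proof.
move=> UV nV; rewrite -icomm_comms; apply: icomm_mono.
by apply: (@icommS_min U 0) => //; case: nV.
Qed.

Lemma commMgl x y z : [~ x * y, z] = [~ x, z] ^ y * [~ y, z].
Proof.
rewrite !commgEl !conjgE !(invgM, invgK, mulgA).
by rewrite !(mulgK, mulgVK, mulgV, mulVg, mulg1, mul1g).
Qed.

Lemma commVgl x y : [~ x^-1, y] = ([~ x, y] ^ x^-1)^-1.
Proof.
rewrite !commgEl !conjgE !(invgM, invgK, mulgA).
by rewrite !(mulgK, mulgVK, mulgV, mulVg, mulg1, mul1g).
Qed.

Lemma Hall_Witt x y z :
  [~ x, y^-1, z] ^ y * [~ y, z^-1, x] ^ z * [~ z, x^-1, y] ^ x = 1.
Proof.
rewrite !commgEl !conjgE !(invgM, invgK, mulgA).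
by rewrite !(mulgK, mulgVK, mulgV, mulVg, mulg1, mul1g).
Qed.

Lemma conj_central K x z : subgroup K -> K [~ x, z] -> K x -> K (x ^ z).
Proof. by move=> [_ _ KM] Kxz Kx; rewrite -[x ^ z](mulKVg x) -commgEl; apply: KM. Qed.

Lemma commg_gen E K y : subgroup K ->
  (forall x z, gen E x -> K [~ x, y] -> K ([~ x, y] ^ z)) ->
  (forall e, E e -> K [~ e, y]) -> forall x, gen E x -> K [~ x, y].
Proof.
move=> [K1 KV KM] KJ KE x.
elim=> [|e Ee|e Ee|u v Eu Ku Ev Kv]; first by rewrite comm1g.
- exact: KE.
- by rewrite commVgl; apply/KV/KJ; [apply: gen_in | apply: KE].
- by rewrite commMgl; apply: KM => //; apply: KJ.
Qed.

(** The three subgroups argument, by induction on [j]: for [y = [u,v]] the Hall-Witt identity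
    expresses [[u,v,x]], up to conjugation, through [[v^-1,x^-1,u]] and [[x,u^-1,v^-1]], to which
    the induction hypothesis applies. *)
Lemma icomm_comm N i j x y : normalsub N ->
  icomm N i x -> icomm full j y -> icomm N (i + j).+1 [~ x, y].
Proof.
move=> nN; elim: j i x y => [|j IH] i x y Nx; first by rewrite addn0 => _; apply: icommS.
have [sK KJ] := icomm_normal (i + j.+1).+1 nN; have [K1 KV KM] := sK.
move=> Gy; apply: subgroupR => //; move: y Gy.
apply: commg_gen => // [y z _|_ [u [v [Gu [_ ->]]]]]; first exact: KJ.
have := Hall_Witt v^-1 x u; rewrite invgK => /eqP.
rewrite mulg_eq1 => /eqP/esym/(canRL (@invgK T)) E.
suff : icomm N (i + j.+1).+1 ([~ u, v, x] ^ v^-1).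
  by move/(KJ _ v); rewrite -conjgM mulVg conjg1.
rewrite E; apply/KV/KM; apply: KJ.
  have := IH i.+1 _ u; rewrite addSn -addnS; apply=> //.
  have [nS _] := icomm_normal i.+1 nN.
  apply: subgroupR nS _; apply: icommS.
  by have [[_ NV _] _] := icomm_normal i nN; apply: NV.
rewrite addnS; apply: icommS; apply: IH => //.
by have [[_ GV _] _] := icomm_normal j normalsub_full; apply: GV.
Qed.

Lemma commg_genr E K x : subgroup K ->
  (forall y z, gen E y -> K [~ x, y] -> K ([~ x, y] ^ z)) ->
  (forall e, E e -> K [~ x, e]) -> forall y, gen E y -> K [~ x, y].
Proof.
move=> sK KJ KE y Ey; apply: subgroupR => //; apply: commg_gen Ey => //.
  move=> {}y z Ey Kyx; rewrite -invgR conjVg; have [_ KV _] := sK.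
  by apply/KV/KJ => //; apply: subgroupR.
by move=> e Ee; apply: subgroupR => //; apply: KE.
Qed.

Lemma commX_mod N x y m : normalsub N -> (forall z, N [~ x, y, z]) ->
  N ([~ x, y] ^+ m * [~ x ^+ m, y]^-1).
Proof.
move=> [[N1 NV NM] NJ] Nc; elim: m => [|m IH]; first by rewrite comm1g invg1 mulg1.
have key a r q e : N (e * q^-1) -> N r -> N (a * e * (a * r * q)^-1).
  move=> Nq Nr; have -> : a * e * (a * r * q)^-1 = (e * q^-1 * r^-1) ^ a^-1.
    by rewrite conjgE !invgM invgK !mulgA.
  by apply/NJ/NM => //; apply: NV.
rewrite !expgS commMgl -[_ ^ (x ^+ m)](mulKVg [~ x, y]) -[_ * (_ ^ _)]commgEl.
exact: key.
Qed.

Lemma expMg_mod N x y m : normalsub N -> (forall z, N [~ y, z]) ->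
  exists2 r, N r & (x * y) ^+ m = x ^+ m * y ^+ m * r.
Proof.
move=> [[N1 NV NM] NJ] Nc; elim: m => [|m [r Nr E]]; first by exists 1; rewrite ?mulg1.
exists ([~ y, x ^+ m] ^ (y ^+ m) * r); first by apply: NM => //; apply: NJ.
rewrite expgS E !expgS !mulgA; congr (_ * _).
by rewrite -(mulgA x y) (commgC y) -!mulgA !(mulKg, mulVKg).
Qed.

(** For [c > 0] the central quotient [S_c / R_c] is generated by commutators [[x,y]] with [x] in
    [S_{c-1}]. There [[x,y]^q] equals [[x^q,y]], which lies in [R_c] as [x^q] lies in [R_{c-1}]. *)
Lemma icomm_exp S R q c : normalsub S -> normalsub R ->
  (forall x y, S x -> R [~ x, y]) -> (forall x, S x -> R (x ^+ q)) ->
  forall x, icomm S c x -> icomm R c (x ^+ q).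
Proof.
move=> nS nR SR Sq; have Sc n x z : icomm S n x -> icomm R n [~ x, z].
  by move=> Sx; apply: icomm_absorb SR nR _ _; apply: icommS.
elim: c => // c IH.
have nRc := icomm_normal c.+1 nR; have [[R1 RV RM] RJ] := nRc.
have [sS _] := icomm_normal c.+1 nS.
(* Membership in [S_{c+1}] is carried along because the power of a product splits only for factors
   that are central modulo [R_{c+1}]. *)
suff H x : icomm S c.+1 x -> icomm S c.+1 x /\ icomm R c.+1 (x ^+ q).
  by move=> x /H[].
move: x; apply: icommS_min.
  split=> [|x [Sx Rx]|x y [Sx Rx] [Sy Ry]]; have [S1 SV SM] := sS.
  - by split=> //; rewrite expg1n.
  - by split; [apply: SV | rewrite expVgn; apply: RV].
  split; first exact: SM.
  have [|r Rr ->] := @expMg_mod _ x y q nRc; first by move=> z; apply: Sc.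
  exact: RM (RM _ _ Rx Ry) Rr.
move=> x y Sx; have Sxy := icommS y Sx; split=> //.
rewrite -[_ ^+ q](mulgVK [~ x ^+ q, y]); apply: RM; last exact/icommS/IH.
by apply: commX_mod nRc _ => z; apply: Sc.
Qed.

(** Commutation of [S_c] with the group is bilinear modulo [R_{c+1}], so generators of [S_c] modulo
    [R_c] and of the group modulo [R] suffice. A general [K] leaves room to rewrite the [[e,y]]. *)
Lemma icomm_step S R Y E c K : normalsub S -> normalsub R ->
  (forall x, R x -> S x) -> (forall x y, S x -> R [~ x, y]) ->
  (forall x, gen (fun y => Y y \/ R y) x) ->
  (forall x, icomm S c x -> gen (fun e => E e \/ icomm R c e) x) ->
  (forall e, E e -> icomm S c e) ->
  subgroup K -> (forall x, icomm R c.+1 x -> K x) ->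
  (forall e y, E e -> Y y -> K [~ e, y]) ->
  forall x, icomm S c.+1 x -> K x.
Proof.
move=> nS nR RS SR genT genS ES sK RK KEY.
have SK x y z : icomm S c x -> K [~ x, y] -> K ([~ x, y] ^ z).
  move=> Sx; apply: conj_central => //; apply: RK.
  by apply: icomm_absorb SR nR _ _; do 2!apply: icommS.
have RcS : forall x, icomm R c x -> icomm S c x by apply: icomm_mono.
apply: (icommS_min sK) => x y /genS.
have genE : forall x, gen (fun e => E e \/ icomm R c e) x -> icomm S c x.
  apply: gen_min; first by case: (icomm_normal c nS).
  by move=> e [/ES|/RcS].
move: x; apply: commg_gen => // [x z /genE|e [Ee|Re]]; first exact: SK.
  apply: (commg_genr sK _ _ (genT y)) => // [u z _|u [|Ru]]; first exact/SK/ES.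
    exact: KEY.
  (* [[R, gamma_{c+1}]] lies in [R_{c+1}], so second entries from [R] contribute nothing. *)
  apply/RK; apply: subgroupR; first by case: (icomm_normal c.+1 nR).
  rewrite -[c]add0n; apply: icomm_comm => //.
  by apply: icomm_mono (ES _ Ee).
by apply: RK; apply: icommS.
Qed.

End Subgroups.

(** For the termination of the rewriting of Lyndon commutators: an increase of the base [D] value
    outweighs any change of the length, lengths being at most [N]. *)
Lemma lex_measure M N g g' k l : g < g' -> g' < M -> k <= N ->
  (M - g') * N.+1 + k < (M - g) * N.+1 + l.
Proof.
move=> gg' g'M kN; apply: (@leq_trans ((M - g) * N.+1)); last exact: leq_addr.
apply: (@leq_trans ((M - g').+1 * N.+1)); first by rewrite mulSn; lia.
by rewrite leq_mul2r; apply/orP; right; lia.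
Qed.

Lemma predn_add m n : 0 < m -> 0 < n -> (m + n).-1 = (m.-1 + n.-1).+1.
Proof. by case: m n => [|m] [|n] //= _ _; rewrite addnS. Qed.

(** * Commutators bracketed along Lyndon words *)

Section LyndonCommutators.
Variables (T : groupType) (R S : T -> Prop).
Hypotheses (nR : normalsub R) (nS : normalsub S).
Hypotheses (RS : forall x, R x -> S x) (SR : forall x y, S x -> R [~ x, y]%g).
Implicit Types (x y z : T) (K E : T -> Prop) (u v w : seq nat).
Local Open Scope group_scope.

(** [grA n s / grQ n s] is a component of degree [n.+1] of a graded Lie ring: of
    the lower central factors of the group if [s] is false, and of the ideal
    formed by the [S_n / R_n] if [s] is true.  For a commutator of letters, [s]
    tells whether it involves the letter that lies in [S]. *)
Definition grA (n : nat) (s : bool) : T -> Prop :=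
  if s then icomm S n else icomm (@full T) n.
Definition grQ (n : nat) (s : bool) : T -> Prop :=
  if s then icomm R n else icomm (@full T) n.+1.

Lemma grA_normal n s : normalsub (grA n s).
Proof. by case: s; apply: icomm_normal => //; apply: normalsub_full. Qed.

Lemma grA_full n s x : grA n s x -> icomm (@full T) n x.
Proof. by case: s => //; apply: icomm_mono. Qed.

Lemma grQ_A n s x : grQ n s x -> grA n s x.
Proof.
by case: s; [apply: icomm_mono | apply: icomm_sub; apply: normalsub_full].
Qed.

Lemma grA_central n s x z : grA n s x -> grQ n s [~ x, z].
Proof.
case: s => Ax; last exact: icommS.
by apply: icomm_absorb SR nR _ _; apply: icommS.
Qed.

Lemma grAA m n s t x y :
  grA m s x -> grA n t y -> grA (m + n).+1 (s || t) [~ x, y].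
Proof.
case: s => Ax Ay; first exact: icomm_comm (grA_full Ay).
have [sA _] := grA_normal (m + n).+1 t; apply: subgroupR => //=.
rewrite addnC; case: t Ay {sA} => Ay; apply: icomm_comm => //.
Qed.

(** The bracket is thus well defined modulo [grQ]. In the mixed case [[S_n, gamma_{m+2}]] lies in
    [S_{m+n+2}], which [icomm_absorb] puts in [R_{m+n+1}]. *)
Lemma grQA m n s t x y :
  grQ m s x -> grA n t y -> grQ (m + n).+1 (s || t) [~ x, y].
Proof.
case: s => Qx Ay; first exact: icomm_comm (grA_full Ay).
case: t Ay => Ay; last by rewrite -addSn; apply: icomm_comm => //; apply: normalsub_full.
apply: subgroupR; first by case: (icomm_normal (m + n).+1 nR).
apply: icomm_absorb SR nR _ _; rewrite addnC -addnS.
exact: icomm_comm.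
Qed.

Lemma conj_mod n s K x z : subgroup K -> (forall e, grQ n s e -> K e) ->
  grA n s x -> K x -> K (x ^ z).
Proof. by move=> sK QK Ax; apply: conj_central => //; apply/QK/grA_central. Qed.

Lemma grA_gen n s E x : (forall e, E e -> grA n s e) ->
  gen (fun e => E e \/ grQ n s e) x -> grA n s x.
Proof.
have [sA _] := grA_normal n s => EA; move: x; apply: gen_min => // e [/EA|] //.
exact: grQ_A.
Qed.

Lemma commg_linear m n s t K E x y : subgroup K ->
  (forall e, grQ (m + n).+1 (s || t) e -> K e) ->
  (forall e, E e -> grA m s e) -> grA n t y ->
  (forall e, E e -> K [~ e, y]) ->
  gen (fun e => E e \/ grQ m s e) x -> K [~ x, y].
Proof.
move=> sK QK EA Ay KE; move: x; apply: commg_gen => // [x z /(grA_gen EA) Ax|e [/KE|Qe]] //.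
  by apply: (@conj_mod (m + n).+1 (s || t)) => //; apply: grAA.
by apply: QK; apply: grQA.
Qed.

(** The Hall-Witt identity for [a], [b^-1], [c]; modulo [grQ] the inverses and the reversed
    commutators only change signs, and conjugation acts trivially. *)
Lemma jacobi_mod i j k r s t K a b c : subgroup K ->
  (forall e, grQ (i + j + k).+2 [|| r, s | t] e -> K e) ->
  grA i r a -> grA j s b -> grA k t c ->
  K [~ [~ a, c], b] -> K [~ a, [~ b, c]] -> K [~ [~ a, b], c].
Proof.
move=> sK QK Aa Ab Ac K1 K2; have [_ KV KM] := sK.
have AV n (u : bool) x : grA n u x -> grA n u x^-1 by move=> Ax; case: (grA_normal n u) => [[_ H _] _]; apply: H.
(* By linearity an entry [x0] may be replaced by anything it generates modulo [grQ], such as an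
   inverse or a reversed commutator. *)
have lin m n (u v : bool) (x0 x y : T) : (m + n).+1 = (i + j + k).+2 ->
    u || v = [|| r, s | t] -> grA m u x0 -> grA n v y -> K [~ x0, y] ->
    gen (fun e => e = x0 \/ grQ m u e) x -> K [~ x, y].
  move=> Em Eu A0 Ay K0; apply: (@commg_linear m n u v) => // [e|e ->|e ->] //.
  by rewrite Em Eu; apply: QK.
have genV m (u : bool) (x y : T) : grA m u [~ x, y] ->
    gen (fun e => e = [~ x, y] \/ grQ m u e) [~ x^-1, y].
  move=> Axy; rewrite commVgl; set G := gen _; have sG : subgroup G by apply: gen_subgroup.
  have [_ GV _] := sG; apply: GV; apply: (@conj_mod m u) => //.
    by move=> e Qe; apply: gen_in; right.
  by apply: gen_in; left.
have genC m (u : bool) (x y : T) : gen (fun e => e = [~ x, y] \/ grQ m u e) [~ y, x].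
  by rewrite -[[~ y, x]]invgR; apply: gen_inv; left.
have genVr m (u : bool) (x y : T) : grA m u [~ y, x] ->
    gen (fun e => e = [~ x, y] \/ grQ m u e) [~ x, y^-1].
  move=> Axy; apply: subgroupR; first exact: gen_subgroup.
  apply: gen_min (genV _ _ _ _ Axy); first exact: gen_subgroup.
  by move=> e [->|Qe]; [apply: genC | apply: gen_in; right].
have Kbca : K [~ b^-1, c^-1, a].
  apply: (lin (j + k).+1 i (s || t) r [~ b, c^-1]); rewrite ?(orbC _ r) //.
  - by lia.
  - by apply: grAA => //; apply: AV.
  - apply: (lin (j + k).+1 i (s || t) r [~ b, c]); rewrite ?(orbC _ r) //.
    + by lia.
    + exact: grAA.
    + exact: subgroupR.
    + by apply: genVr; rewrite orbC addnC; apply: grAA.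
  - by apply: genV; apply: grAA => //; apply: AV.
have Kcab : K [~ c, a^-1, b^-1].
  have eb : t || r || s = [|| r, s | t] by case: (r) (s) (t) => [] [] [].
  have Kca : K [~ c, a, b].
    apply: (lin (k + i).+1 j (t || r) s [~ a, c]) => //; first by lia.
    by rewrite orbC addnC; apply: grAA.
  apply: subgroupR => //; apply: (lin j (k + i).+1 s (t || r) b).
  - by lia.
  - by rewrite orbC.
  - by [].
  - by apply: grAA => //; apply: AV.
  - apply: subgroupR => //; apply: (lin (k + i).+1 j (t || r) s [~ c, a]) => //.
    + by lia.
    + exact: grAA.
    + by apply: genVr; rewrite orbC addnC; apply: grAA.
  - by apply: gen_inv; left.
have Aabc : grA (i + j + k).+2 [|| r, s | t] [~ a, b, c].
  have -> : (i + j + k).+2 = ((i + j).+1 + k).+1 by lia.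
  by rewrite orbA; do 2!apply: grAA => //.
have := Hall_Witt a b^-1 c; rewrite invgK -mulgA => /eqP.
rewrite mulg_eq1 => /eqP E.
have Kabc : K ([~ a, b, c] ^ b^-1).
  rewrite E; apply/KV/KM; apply: (@conj_mod (i + j + k).+2 [|| r, s | t]) => //.
    have -> : (i + j + k).+2 = ((j + k).+1 + i).+1 by lia.
    have -> : [|| r, s | t] = (s || t) || r by rewrite orbC.
    by apply: grAA => //; apply: grAA; apply: AV.
  have -> : (i + j + k).+2 = ((k + i).+1 + j).+1 by lia.
  have -> : [|| r, s | t] = (t || r) || s by case: (r) (s) (t) => [] [] [].
  by apply: grAA; [apply: grAA => // |]; apply: AV.
rewrite -[[~ a, b, c]](conjgKV b).
have [[_ _ _] AJ] := grA_normal (i + j + k).+2 [|| r, s | t].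
exact: (conj_mod _ sK QK (AJ _ _ Aabc) Kabc).
Qed.

Variables (X : nat -> T) (d : nat).
Hypothesis (Xd : S (X d)).

(** [n] is fuel for a recursion on the length; for nonempty [w], every value from [size w] on gives
    the same result. *)
Fixpoint lyndon_comm_rec n w : T :=
  if n is n'.+1 then
    if size w <= 1 then X (head 0 w)
    else [~ lyndon_comm_rec n' (lfactor w), lyndon_comm_rec n' (rfactor w)]
  else 1.

Definition lyndon_comm w := lyndon_comm_rec (size w) w.

Lemma size_factor w : 1 < size w ->
  [/\ 0 < size (lfactor w), 0 < size (rfactor w) &
      size (lfactor w) + size (rfactor w) = size w].
Proof.
move=> w1; have [ln rn] := factor_neq0 w1.
by rewrite -size_cat factor_cat; split=> //; case: (lfactor w) (rfactor w) ln rn => [|? ?] [].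
Qed.

Lemma lyndon_comm_recE n w : 0 < size w <= n -> lyndon_comm_rec n w = lyndon_comm w.
Proof.
rewrite /lyndon_comm; elim: n {-2}n (leqnn n) w => [|m IH] [|n] nm w //=; try by lia.
case E: (size w) => [|k] //= kn; rewrite E.
case: ifP => // w1; have [|l0 r0 lr] := @size_factor w; first by rewrite E ltnNge w1.
by rewrite !IH //; lia.
Qed.

Lemma lyndon_commE w : 1 < size w ->
  lyndon_comm w = [~ lyndon_comm (lfactor w), lyndon_comm (rfactor w)].
Proof.
move=> w1; have [l0 r0 lr] := size_factor w1.
rewrite {1}/lyndon_comm; case E: (size w) w1 lr => [|k] // w1 lr /=.
by rewrite E leqNgt w1 /= !lyndon_comm_recE //; lia.
Qed.

Lemma lyndon_comm_grA w : 0 < size w ->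
  grA (size w).-1 (d \in w) (lyndon_comm w).
Proof.
elim: {w}(size w) {-2}w (leqnn (size w)) => [|n IH] w wn w0; first by lia.
have [w1|w1] := leqP (size w) 1.
  case: w wn w0 w1 => [|x [|]] //= _ _ _; rewrite inE /lyndon_comm /=.
  by case: eqP => [<-|].
have [l0 r0 lr] := size_factor w1.
have -> : (d \in w) = (d \in lfactor w) || (d \in rfactor w).
  by rewrite -mem_cat factor_cat.
have -> : (size w).-1 = ((size (lfactor w)).-1 + (size (rfactor w)).-1).+1 by lia.
by rewrite lyndon_commE //; apply: grAA; apply: IH => //; lia.
Qed.

(** The span of the Lyndon commutators of the same multidegree as [lo] that lie
    in the interval [lo, hi[. *)
Definition lyndon_span lo hi : T -> Prop :=
  gen (fun y =>
    (exists w, [/\ lyndon w, perm_eq w lo, (lo <= w)%O, (w < hi)%O & y = lyndon_comm w]) \/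
    grQ (size lo).-1 (d \in lo) y).

Lemma lyndon_span_mono lo hi lo' hi' : perm_eq lo' lo -> (lo <= lo')%O -> (hi' <= hi)%O ->
  forall x, lyndon_span lo' hi' x -> lyndon_span lo hi x.
Proof.
move=> pl ll hh; apply: gen_mono => x [[w [wL pw lw wh ->]]|Qx].
  left; exists w; split=> //; first exact: perm_trans pw pl.
    exact: le_trans ll lw.
  exact: lt_le_trans wh hh.
by right; rewrite -(perm_size pl) -(perm_mem pl).
Qed.

Lemma lyndon_size_gt0 w : lyndon w -> 0 < size w.
Proof. by case/lyndonP; case: w. Qed.

Lemma comm_span_linear lo hi u v w K : subgroup K ->
  0 < size lo -> lyndon w ->
  (forall e, grQ ((size lo).-1 + (size w).-1).+1 ((d \in lo) || (d \in w)) e -> K e) ->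
  (forall t, lyndon t -> perm_eq t lo -> (lo <= t)%O -> (t < hi)%O ->
     K [~ lyndon_comm t, lyndon_comm w]) ->
  forall x, lyndon_span lo hi x -> K [~ x, lyndon_comm w].
Proof.
move=> sK lo0 wL QK KE x; apply: commg_linear sK QK _ _ _.
- move=> e [t [tL pt _ _ ->]]; rewrite -(perm_size pt) -(perm_mem pt).
  exact/lyndon_comm_grA/lyndon_size_gt0.
- exact/lyndon_comm_grA/lyndon_size_gt0.
- by move=> e [t [tL pt lt th ->]]; apply: KE.
Qed.

(** When [u = ab] is a standard factorization with [b < v], Jacobi replaces
    [[u,v]] by [[[a,v],b]] and [[a,[b,v]]].  The inner commutators are shorter; the
    outer ones [[u',v']] that come out of expanding them satisfy [u'v' > uv], or
    [u'v' = uv] with [u'] shorter than [u]. *)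
Lemma lyndon_comm_rewrite (D : nat) u v : lyndon u -> lyndon v -> (u < v)%O ->
  all (fun i : nat => i < D) (u ++ v) ->
  lyndon_span (u ++ v) v [~ lyndon_comm u, lyndon_comm v].
Proof.
have [n] := ubnP (size (u ++ v)); elim: n u v => // n IHn u v; rewrite ltnS => uvn.
(* Within a fixed length, the inner induction lets the word [u ++ v] grow, its base [D] value being
   bounded, and for a fixed word lets [size u] shrink. *)
have [m] := ubnP ((D ^ size (u ++ v) - digits D (u ++ v)) * (size (u ++ v)).+1 + size u).
elim: m u v uvn => // m IHm u v uvn; rewrite ltnS => uvm uL vL uv uvD.
have sK : subgroup (lyndon_span (u ++ v) v) by apply: gen_subgroup.
have u0 := lyndon_size_gt0 uL; have v0 := lyndon_size_gt0 vL.
have [std|nstd] := boolP ((size u <= 1) || (v <= rfactor u)%O).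
  have [|El Er] := factor_cat_lyndon uL vL; first by case/orP: std; [left | right].
  apply: gen_in; left; exists (u ++ v); split=> //.
  - exact: lyndon_cat.
  - by apply: lyndon_suffix (lyndon_cat uL vL uv) _ _; apply: lyndon_neq0.
  - have uv1 : 1 < size (u ++ v) by rewrite size_cat; lia.
    by rewrite (lyndon_commE uv1) El Er.
move: nstd; rewrite negb_or -ltnNge -ltNge => /andP[u1 rv].
rewrite (lyndon_commE u1).
have Eu := factor_cat u; have lL := lfactor_lyndon uL u1; have rL := rfactor_lyndon uL u1.
have lr := lfactor_lt uL u1.
move: (lfactor u) (rfactor u) Eu lL rL lr rv => a b Eu aL bL ab bv.
have a0 := lyndon_size_gt0 aL; have b0 := lyndon_size_gt0 bL.
have au : (a < u)%O by rewrite -Eu ltxi_catr //; case: (b) b0.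
have av : (a < v)%O by apply: lt_trans uv.
have ub : (u < b)%O by rewrite -Eu; apply: lyndon_suffix; rewrite ?Eu //; apply: lyndon_neq0.
have IH u' v' : lyndon u' -> lyndon v' -> (u' < v')%O ->
    perm_eq (u' ++ v') (u ++ v) -> (v' <= v)%O ->
    (u ++ v < u' ++ v')%O \/ u' ++ v' = u ++ v /\ size u' < size u ->
    lyndon_span (u ++ v) v [~ lyndon_comm u', lyndon_comm v'].
  move=> uL' vL' uv' puv vv' lt_uv.
  have uvD' : all (fun i : nat => i < D) (u' ++ v') by rewrite (perm_all _ puv).
  apply: (lyndon_span_mono puv _ vv').
    by case: lt_uv => [/ltW|[-> _]].
  apply: IHm => //; first by rewrite (perm_size puv).
  rewrite (perm_size puv); case: lt_uv => [lt_uv|[-> lt_u]]; last first.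
    by apply: leq_trans uvm; rewrite ltn_add2l.
  have lt_dg := ltxi_digits (esym (perm_size puv)) uvD uvD' lt_uv.
  have dg_bound := digits_bound uvD'; rewrite (perm_size puv) in dg_bound.
  have size_u' : size u' <= size (u ++ v) by rewrite -(perm_size puv) size_cat leq_addr.
  exact: leq_trans (lex_measure _ lt_dg dg_bound size_u') uvm.
clear m uvm IHm.
apply: (@jacobi_mod (size a).-1 (size b).-1 (size v).-1 (d \in a) (d \in b) (d \in v)) => //;
  try exact: lyndon_comm_grA.
- move=> e Qe; apply: gen_in; right; rewrite -Eu !size_cat !mem_cat -orbA.
  by rewrite !predn_add ?addn_gt0 ?a0 // addSn.
- apply: (@comm_span_linear (a ++ v) v) => //; first by rewrite size_cat addn_gt0 a0.
  + move=> e Qe; apply: gen_in; right; rewrite -Eu !size_cat !mem_cat.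
    rewrite addnAC predn_add ?addn_gt0 ?a0 //.
    by rewrite orbAC -mem_cat -size_cat.
  + move=> t tL pt lt tv.
    have ptb : perm_eq (t ++ b) (u ++ v).
      apply: (@perm_trans _ ((a ++ v) ++ b)); first by rewrite perm_cat2r.
      by rewrite -Eu perm_catAC.
    (* [bv] is Lyndon, so [bv < v <= vb]. Hence [uv = abv < avb <= tb], the last because [t >= av]
       and both have the same length. *)
    have lt_tb : (u ++ v < t ++ b)%O.
      have bvb : (b ++ v < v ++ b)%O.
        apply: lt_le_trans (lexi_catr v b).
        by apply: lyndon_suffix (lyndon_cat bL vL bv) _ _; apply: lyndon_neq0.
      rewrite -Eu -catA; apply: (@lt_le_trans _ _ ((a ++ v) ++ b)).
        by rewrite -catA ltxi_cat2l.
      move: lt; rewrite le_eqVlt => /orP[/eqP <-|lt] //.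
      by apply/ltW/ltxi_cat_size => //; rewrite (perm_size pt).
    case: (ltgtP t b) => [tb|bt|->]; last by rewrite commgg; apply: gen_one.
    * by apply: IH => //; [exact: ltW | left].
    (* [u < b] and [b] is not longer than [u], so [bt] exceeds [uv] as well. *)
    * apply: subgroupR => //; apply: IH => //; [by rewrite perm_catC | exact: ltW | left].
      by apply: ltxi_cat_size ub _; rewrite -Eu size_cat leq_addl.
  + apply: IHn => //.
      by apply: leq_trans uvn; rewrite -Eu !size_cat ltn_add2r -addn1 leq_add2l.
    by move: uvD; rewrite -Eu !all_cat => /andP[/andP[-> _] ->].
- apply: subgroupR => //.
  apply: (@comm_span_linear (b ++ v) v) => //; first by rewrite size_cat addn_gt0 b0.
  + move=> e Qe; apply: gen_in; right; rewrite -Eu !size_cat !mem_cat.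
    rewrite -addnA addnC predn_add ?addn_gt0 ?b0 //.
    by rewrite -orbA orbC -mem_cat -size_cat.
  + move=> t tL pt lt tv; apply: subgroupR => //; apply: IH => //.
    * exact: lt_le_trans ab (le_trans (lexi_catr b v) lt).
    * by rewrite -Eu -catA perm_cat2l.
    * exact: ltW.
    (* For [t = bv] the word [at] is [uv] again, and the progress is that [a] is shorter than [u];
       otherwise [at > uv]. *)
    * move: lt; rewrite le_eqVlt => /orP[/eqP <-|lt]; [right|left].
        by rewrite catA Eu; split=> //; rewrite -Eu size_cat -[X in (X < _)%N]addn0 ltn_add2l.
      by rewrite -Eu -catA ltxi_cat2l.
  + apply: IHn => //.
      by apply: leq_trans uvn; rewrite -Eu !size_cat -addnA -add1n leq_add2r.
    by move: uvD; rewrite -Eu -catA !all_cat => /andP[_].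
Qed.

End LyndonCommutators.

(** * Index bounds through coset covers *)

Section Covers.
Variable T : groupType.
Implicit Types (x y z a : T) (A B N R S : T -> Prop) (es Y : seq T).
Local Open Scope group_scope.

(** Coset representatives may lie outside [A], so that the bound passes to every subset of [A]. *)
Definition index_le A N m :=
  exists s : seq T, size s <= m /\ forall a, A a -> exists2 w, w \in s & N (w^-1 * a).

Lemma index_le_trans A B N m1 m2 : index_le A B m1 -> index_le B N m2 -> index_le A N (m1 * m2).
Proof.
move=> [s1 [sz1 H1]] [s2 [sz2 H2]]; exists [seq x * y | x <- s1, y <- s2]; split.
  by rewrite size_allpairs leq_mul.
move=> a /H1[w ws /H2[v vs Nv]]; exists (w * v); last by rewrite invgM -mulgA.
by apply/allpairsP; exists (w, v).
Qed.

Lemma index_le_sub A B N m : (forall x, A x -> B x) -> index_le B N m -> index_le A N m.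
Proof. by move=> AB [s [sz H]]; exists s; split=> // a /AB/H. Qed.

Lemma index_le_weaken A N m1 m2 : m1 <= m2 -> index_le A N m1 -> index_le A N m2.
Proof. by move=> le12 [s [sz H]]; exists s; split=> //; apply: leq_trans le12. Qed.

Lemma commX_normal N x z i : normalsub N -> (forall z, N [~ x, z]) -> N [~ x ^+ i, z].
Proof.
move=> [[N1 NV NM] NJ] Nx; elim: i => [|i IH]; first by rewrite comm1g.
by rewrite expgS commMgl; apply: NM => //; apply: NJ.
Qed.

(** Modulo [N] the members of [es] are central of exponent dividing [q], so products of powers [e^i]
    with [i < q] represent all cosets. *)
Lemma index_le_gen A N es q : normalsub N -> 0 < q ->
  (forall e z, e \in es -> N [~ e, z]) -> (forall e, e \in es -> N (e ^+ q)) ->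
  (forall a, A a -> gen (fun y => y \in es \/ N y) a) ->
  index_le A N (q ^ size es).
Proof.
move=> nN q0 Nc Nq genA; apply: index_le_sub genA _; move: Nc Nq; have [[N1 NV NM] NJ] := nN.
elim: es => [|e es IH] Nc Nq.
  exists [:: 1]; split=> // a Na; exists 1; rewrite ?inE // invg1 mul1g.
  by apply: gen_min Na => // y [].
have [|//|s [sz Hs]] := IH.
- by move=> x z xes; apply: Nc; rewrite inE xes orbT.
- by move=> x xes; apply: Nq; rewrite inE xes orbT.
exists [seq e ^+ i * w | i <- iota 0 q, w <- s]; split.
  by rewrite size_allpairs size_iota expnS leq_mul.
set P := gen _ in Hs; have [P1 PV PM] : subgroup P by apply: gen_subgroup.
have NP y : N y -> P y by move=> Ny; apply: gen_in; right.
have Ne z : N [~ e, z] by apply: Nc; rewrite mem_head.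
have Neq : N (e ^+ q) by apply: Nq; rewrite mem_head.
move=> a Pa; have [i [y Py ->]] : exists i, exists2 y, P y & a = e ^+ i * y.
  elim: Pa => [|x Px|x Px|x x' _ [i [y Py ->]] _ [j [y' Py' ->]]].
  - by exists 0, 1; rewrite ?mulg1.
  - case: Px => [|Nx]; last by exists 0, x; rewrite ?mul1g //; apply: NP.
    rewrite inE => /orP[/eqP ->|xes]; first by exists 1%N, 1; rewrite ?mulg1.
    by exists 0, x; rewrite ?mul1g //; apply: gen_in; left.
  - case: Px => [|Nx]; last by exists 0, x^-1; rewrite ?mul1g //; apply/PV/NP.
    rewrite inE => /orP[/eqP ->|xes]; last first.
      by exists 0, x^-1; rewrite ?mul1g //; apply/PV/gen_in; left.
    (* [e^-1 = e^(q-1) e^-q], and [e^-q] lies in [N]. *)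
    exists q.-1, (e ^- q); first exact/PV/NP.
    by rewrite -{2}(prednK q0) expgS invgM mulKVg.
  exists (i + j), (y * [~ y, e ^+ j] * y').
    apply: (PM) => //; apply: (PM) => //; apply: NP.
    by apply: subgroupR => //; apply: commX_normal.
  by rewrite expgnDr commgEl mulKVg conjgE !mulgA mulgK.
(* The exponent is reduced modulo [q] by absorbing the surplus power of [e^q] into [y]. *)
have [|w ws Nw] := Hs ((e ^+ q) ^+ (i %/ q) * y).
  apply: PM Py; apply: NP; elim: (_ %/ _) => [|k IHk]; first by rewrite expg0.
  by rewrite expgS; apply: NM.
exists (e ^+ (i %% q) * w).
  by apply/allpairsP; exists (i %% q, w); rewrite mem_iota ltn_mod.
by rewrite {2}(divn_eq i q) addnC expgnDr mulnC expgnA invgM -!mulgA mulKg.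
Qed.
End Covers.

(** * The index of [R_c] in [S_c] for one central step *)

Section Steps.
Variables (T : groupType) (R S : T -> Prop).
Hypotheses (nR : normalsub R) (nS : normalsub S).
Hypotheses (RS : forall x, R x -> S x) (SR : forall x y, S x -> R [~ x, y]%g).
Local Open Scope group_scope.
Variable q : nat.
Hypotheses (q_gt0 : 0 < q) (Sq : forall x, S x -> R (x ^+ q)).

Lemma index_le_icomm es c :
  (forall e, e \in es -> icomm S c e) ->
  (forall x, icomm S c x -> gen (fun y => y \in es \/ icomm R c y) x) ->
  index_le (icomm S c) (icomm R c) (q ^ size es).
Proof.
move=> esS genS; apply: index_le_gen => //; first exact: icomm_normal.
  by move=> e z /esS Se; apply: icomm_absorb SR nR _ _; apply: icommS.
by move=> e /esS Se; apply: icomm_exp Se.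
Qed.

Section LyndonStep.
Variables (X : nat -> T) (d : nat).
Hypothesis genT : forall x, gen (fun y => (exists2 i, i <= d & y = X i) \/ R y) x.
Hypothesis Xd : S (X d).
Hypothesis genS : forall x, S x -> gen (fun y => y = X d \/ R y) x.

(** Induction on [n]: a single letter is a Lyndon word, so the rewriting turns the commutator of [w]
    with [X i] into Lyndon commutators of the same multidegree, and the letter [d] persists. *)
Lemma lyndon_gen n x : icomm S n x ->
  gen (fun y => (exists w, [/\ w \in lyndon_words n.+1 d.+1, d \in w & y = lyndon_comm X w])
                \/ icomm R n y) x.
Proof.
elim: n x => [|n IH] x.
  move=> /genS; apply: gen_mono => y [->|]; last by right.
  left; exists [:: d]; rewrite mem_head mem_filter mem_words /=.
  by rewrite ltnSn.
set G := gen _; have sG : subgroup G by apply: gen_subgroup.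
move: x; apply: (icomm_step nS nR RS SR genT IH) => //.
- move=> _ [w [+ dw ->]]; rewrite mem_filter mem_words => /andP[wL /andP[/eqP sw _]].
  have := lyndon_comm_grA nS Xd (lyndon_size_gt0 wL).
  by rewrite sw dw.
- by move=> x Rx; apply: gen_in; right.
move=> _ _ [w [+ dw ->]] [i id ->].
rewrite mem_filter mem_words => /andP[wL /andP[/eqP sw wD]].
have H u v : lyndon u -> lyndon v -> (u < v)%O -> perm_eq (u ++ v) (w ++ [:: i]) ->
    G [~ lyndon_comm X u, lyndon_comm X v].
  move=> uL vL uv puv.
  have uvD : all (fun i : nat => i < d.+1) (u ++ v).
    by rewrite (perm_all _ puv) all_cat wD /= ltnS id.
  have := lyndon_comm_rewrite nR nS RS SR Xd uL vL uv uvD.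
  move: [~ _, _]; apply: gen_min sG _ => y [[t [tL pt _ _ ->]]|].
    have pt' := perm_trans pt puv.
    apply: gen_in; left; exists t; split=> //.
      rewrite mem_filter mem_words tL (perm_size pt') (perm_all _ pt) uvD.
      by rewrite size_cat sw addn1 eqxx.
    by rewrite (perm_mem pt') mem_cat dw.
  rewrite (perm_size puv) (perm_mem puv) mem_cat dw size_cat sw addn1 => Ry.
  by apply: gen_in; right.
have -> : X i = lyndon_comm X [:: i] by [].
case: (ltgtP w [:: i]) => [wi|iw|->]; last by rewrite commgg; apply: gen_one.
  by apply: H.
by apply: subgroupR => //; apply: H => //; rewrite perm_catC.
Qed.

(** This makes the exponents of successive central steps telescope: the Lyndon words avoiding the
    last letter [d] are those on [d] letters. *)
Lemma lyndon_words_letter n :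
  size [seq w <- lyndon_words n d.+1 | d \in w] + size (lyndon_words n d) =
  size (lyndon_words n d.+1).
Proof.
rewrite -[RHS](count_predC (fun w : seq nat => d \in w)) size_filter; congr addn.
rewrite -size_filter; apply/perm_size/uniq_perm; rewrite ?filter_uniq ?words_uniq //.
move=> w; rewrite !mem_filter !mem_words /= [RHS]andbCA; congr (_ && _).
rewrite [RHS]andbCA; congr (_ && _); apply/allP/andP => [H|[dw /allP H] x xw].
  split; first by apply/negP => /H; rewrite ltnn.
  by apply/allP => x /H /ltnW; rewrite ltnS.
by rewrite ltn_neqAle -ltnS H // andbT; apply: contraNneq dw => <-.
Qed.

Lemma lyndon_index_le c : index_le (icomm S c) (icomm R c)
  (q ^ size [seq w <- lyndon_words c.+1 d.+1 | d \in w]).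
Proof.
rewrite -(size_map (lyndon_comm X)); apply: index_le_icomm.
  move=> _ /mapP[w + ->]; rewrite !mem_filter mem_words.
  move=> /andP[dw /andP[wL /andP[/eqP sw _]]].
  have := lyndon_comm_grA nS Xd (lyndon_size_gt0 wL).
  by rewrite sw dw.
move=> x /lyndon_gen; apply: gen_mono => y [[w [wL dw ->]]|]; last by right.
by left; apply: map_f; rewrite mem_filter dw.
Qed.
End LyndonStep.

(** Each further commutation brackets every generator with [b] or a member of [Y], multiplying their
    number by [size Y + 1]. *)
Lemma left_normed_index_le (b : T) (Y : seq T) c : S b ->
  (forall x, S x -> gen (fun y => y = b \/ R y) x) ->
  (forall x, gen (fun y => y \in b :: Y \/ R y) x) ->
  index_le (icomm S c.+1) (icomm R c.+1) (q ^ (size Y * (size Y).+1 ^ c)).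
Proof.
move=> Sb genS genT.
suff [es [<- esS genes]] : exists es : seq T,
  [/\ size es = (size Y * (size Y).+1 ^ c)%N, forall e, e \in es -> icomm S c.+1 e &
   forall x, icomm S c.+1 x -> gen (fun y => y \in es \/ icomm R c.+1 y) x].
  exact: index_le_icomm.
elim: c => [|c [es [sz esS genes]]].
  exists [seq [~ b, y] | y <- Y]; split.
  - by rewrite size_map muln1.
  - by move=> _ /mapP[y _ ->]; apply: (@icommS _ S 0).
  apply: (@icomm_step _ S R _ (fun y => y = b) 0 _ nS nR RS SR genT genS) => //.
  - by move=> _ ->.
  - exact: gen_subgroup.
  - by move=> x Rx; apply: gen_in; right.
  (* [[b,b] = 1], so the first entry after [b] has only [size Y] choices. *)
  move=> _ y -> ; rewrite inE => /orP[/eqP ->|Yy].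
    by rewrite commgg; apply: gen_one.
  by apply: gen_in; left; apply: map_f.
exists [seq [~ e, y] | e <- es, y <- b :: Y]; split.
- by rewrite size_allpairs sz -mulnA -expnSr.
- by move=> _ /allpairsP[[e y] /= [ees _ ->]]; exact: (@icommS _ S c.+1 e y (esS _ ees)).
apply: (icomm_step nS nR RS SR genT genes) => //.
- exact: gen_subgroup.
- by move=> x Rx; apply: gen_in; right.
by move=> e y ees Yy; apply: gen_in; left; apply/allpairsP; exists (e, y).
Qed.
End Steps.

(** * Kernels of maps to finite groups *)

Section Morphisms.
Variables (T : groupType) (gT : finGroupType) (f : T -> gT).
Hypothesis fM : {morph f : x y / (x * y)%g}.
Local Open Scope group_scope.

Definition kernel : T -> Prop := fun x => f x = 1.

Lemma mor1 : f 1 = 1.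
Proof. by apply: (mulgI (f 1)); rewrite -fM !mulg1. Qed.

Lemma morV x : f x^-1 = (f x)^-1.
Proof. by apply: (mulgI (f x)); rewrite -fM !mulgV mor1. Qed.

Lemma morR x y : f [~ x, y] = [~ f x, f y].
Proof. by rewrite !commgEl !conjgE !(fM, morV). Qed.

Lemma morX x i : f (x ^+ i) = f x ^+ i.
Proof. by elim: i => [|i IH]; rewrite ?mor1 // !expgS fM IH. Qed.

Lemma kernel_normal : normalsub kernel.
Proof.
split; first split; rewrite /kernel ?mor1 //.
- by move=> x fx; rewrite morV fx invg1.
- by move=> x y fx fy; rewrite fM fx fy mulg1.
by move=> x z fx; rewrite conjgE !fM morV fx mul1g mulVg.
Qed.

Lemma lcn_lift (G : {group gT}) c : (forall a, a \in G -> exists x, f x = a) ->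
  forall a, a \in 'L_c.+1(G) -> exists2 x, icomm (@full T) c x & f x = a.
Proof.
move=> fonto; elim: c => [|c IH] a.
  by rewrite lcn1 => /fonto[x <-]; exists x.
rewrite lcnSn => /gen_prodgP[n [e eP ->]].
elim/big_ind: _ => [|_ _ [x Gx <-] [y Gy <-]|i _].
- by exists 1; [apply: gen_one | apply: mor1].
- by exists (x * y); [apply: gen_mul | apply: fM].
have /imset2P[u v /IH[x Gx <-] /fonto[y <-] ->] := eP i.
by exists [~ x, y]; [apply: icommS | apply: morR].
Qed.
End Morphisms.

(** * Index bounds along central extensions of finite [p]-groups *)

Section PGroupIndex.
Local Open Scope group_scope.

Lemma cyclic_kernel_gen (T : groupType) (gT : finGroupType) (f : T -> gT) (b x : T) :
  {morph f : x y / x * y} -> f x \in <[f b]> ->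
  gen (fun y => y = b \/ kernel f y) x.
Proof.
move=> fM /cycleP[i fx]; set P := gen _.
have [P1 PV PM] : subgroup P by apply: gen_subgroup.
rewrite -[x](mulKVg (b ^+ i)); apply: (PM).
  elim: i {fx} => // i IH; rewrite expgS; apply: (PM) => //.
  by apply: gen_in; left.
by apply: gen_in; right; rewrite /kernel fM (morV fM) (morX fM) fx mulVg.
Qed.

Section CentralExtension.
Variables (T : groupType) (gT : finGroupType) (G : {group gT}) (f : T -> gT) (b : T).
Hypotheses (fM : {morph f : x y / x * y}) (fG : forall x, f x \in G).
Hypotheses (fonto : forall a, a \in G -> exists x, f x = a).
Hypothesis (bZ : f b \in 'Z(G)).
(** With [R = kernel f] and [S = kernel f'] this is the setting of a central step: [S] is generated
    by [b] and [R], and [[S,T] <= R] because [f b] is central. *)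
Let f' : T -> coset_of <[f b]> := fun x => coset <[f b]> (f x).

Lemma center_cycle_normal : <[f b]> <| G.
Proof. by apply: sub_center_normal; rewrite cycle_subG. Qed.

Lemma quotient_mor : {morph f' : x y / x * y}.
Proof.
move=> x y; rewrite /f' fM morphM //;
  by apply: (subsetP (normal_norm center_cycle_normal)); apply: fG.
Qed.

Lemma quotient_im x : f' x \in G / <[f b]>.
Proof. exact: mem_quotient. Qed.

Lemma quotient_onto a : a \in G / <[f b]> -> exists x, f' x = a.
Proof. by case/morphimP => y _ /fonto[x <-] ->; exists x. Qed.

Lemma kernel_quotient x : kernel f' x -> f x \in <[f b]>.
Proof.
move=> fx; apply: coset_idr fx.
by apply: (subsetP (normal_norm center_cycle_normal)); apply: fG.
Qed.

Lemma kernel_sub_quotient x : kernel f x -> kernel f' x.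
Proof. by rewrite /kernel /f' => ->; rewrite morph1. Qed.

Lemma kernel_quotient_central x y : kernel f' x -> kernel f [~ x, y].
Proof.
move=> /kernel_quotient fx; rewrite /kernel (morR fM); apply/eqP/commgP.
have : f x \in 'Z(G) by move: fx; apply/subsetP; rewrite cycle_subG.
by case/centerP => _; apply; apply: fG.
Qed.

Lemma kernel_quotient_exp x : kernel f' x -> kernel f (x ^+ #[f b]).
Proof.
move=> /kernel_quotient fx; rewrite /kernel (morX fM).
by case/cycleP: fx => i ->; rewrite expgAC expg_order expg1n.
Qed.

Lemma kernel_quotient_gen x : kernel f' x -> gen (fun y => y = b \/ kernel f y) x.
Proof. by move=> /kernel_quotient; apply: cyclic_kernel_gen. Qed.

Lemma quotient_gen_lift (Y : seq T) : (forall x, gen (fun y => y \in Y \/ kernel f' y) x) ->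
  forall x, gen (fun y => y \in b :: Y \/ kernel f y) x.
Proof.
move=> genT x; move: (genT x); apply: gen_min; first exact: gen_subgroup.
move=> y [yY|/kernel_quotient_gen]; first by apply: gen_in; left; rewrite inE yY orbT.
by apply: gen_mono => z [->|]; [left; rewrite mem_head | right].
Qed.
End CentralExtension.

(** Induction on [m]: a central subgroup of order [p] puts [S_c] between [gamma_{c+1}] and [R_c],
    with [S] the kernel onto the smaller quotient. The list [Y] is carried along to supply the
    letters, each step adding [b] as a new one. *)
Lemma pgroup_index (T : groupType) (p : nat) : prime p ->
  forall m (gT : finGroupType) (G : {group gT}) (f : T -> gT),
  {morph f : x y / x * y} -> (forall x, f x \in G) ->
  (forall a, a \in G -> exists x, f x = a) -> #|G| = (p ^ m)%N ->
  (exists2 Y : seq T, size Y = m & forall x, gen (fun y => y \in Y \/ kernel f y) x) /\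
  forall c, index_le (icomm (@full T) c) (icomm (kernel f) c)
                  (p ^ size (lyndon_words c.+1 m)).
Proof.
move=> p_pr; elim=> [|m IH] gT G f fM fG fonto oG.
  have kf x : kernel f x.
    by apply/eqP; rewrite -in_set1 -[[set 1]](card1_trivg oG).
  split; first by exists [::] => // x; apply: gen_in; right.
  move=> c; exists [:: 1]; split; first by rewrite expn_gt0 prime_gt0.
  move=> a Ga; exists 1; rewrite ?inE // invg1 mul1g.
  exact: icomm_mono Ga.
have pG : p.-group G by rewrite /pgroup oG pnatX pnat_id.
have Z1 : 'Z(G) != 1.
  apply/eqP => /(trivg_center_pgroup pG) G1; have := ltn_expl m.+1 (prime_gt1 p_pr).
  by rewrite -oG G1 cards1.
have [z zZ oz] : {z | z \in 'Z(G) & #[z] = p}.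
  apply: Cauchy => //; have [] := pgroup_pdiv (pgroupS (center_sub G) pG) Z1.
  by [].
have [b fb] := fonto z (subsetP (center_sub G) z zZ).
have bZ : f b \in 'Z(G) by rewrite fb.
pose f' x := coset <[f b]> (f x).
have := IH _ (G / <[f b]>)%G f' (quotient_mor fM fG bZ) (@quotient_im _ _ _ _ b fG)
  (@quotient_onto _ _ _ _ b fonto).
case.
  rewrite card_quotient ?normal_norm ?center_cycle_normal //.
  rewrite -divgS ?cycle_subG ?fG // -/(order _) fb oz oG expnS mulKn //.
  exact: prime_gt0.
move=> [Y sY genT'] cov'.
have genT := quotient_gen_lift fM fG bZ genT'.
split; first by exists (b :: Y); rewrite /= ?sY.
move=> c; have nf := kernel_normal fM.
have nf' : normalsub (kernel f') by apply/kernel_normal/quotient_mor.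
(* In [nth b Y] the positions below [m = size Y] give [Y], and the position [m] falls on the default
   value [b]. *)
have := @lyndon_index_le _ (kernel f) (kernel f') nf nf' (@kernel_sub_quotient _ _ f b)
  (kernel_quotient_central fM fG bZ) p (prime_gt0 p_pr) _ (nth b Y) m _ _ _ c.
move=> cov; rewrite -lyndon_words_letter addnC expnD; apply: index_le_trans (cov' c) (cov _ _ _ _).
- by move=> x /(kernel_quotient_exp fM fG bZ); rewrite fb oz.
- move=> x; apply: gen_mono (genT x) => y [|]; last by right.
  rewrite inE => /orP[/eqP ->|yY]; left.
    by exists m => //; rewrite nth_default ?sY.
  exists (index y Y); last by rewrite nth_index.
  by rewrite -sY index_size.
- rewrite nth_default ?sY //; rewrite /kernel /f'.
  by apply/coset_id/cycle_id.
- move=> x /(kernel_quotient_gen fM fG bZ).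
  by rewrite nth_default ?sY.
Qed.
End PGroupIndex.

Lemma gamma_index_bound (T : groupType) (gT : finGroupType) (G B : {group gT})
    (f : T -> gT) (p n c k d : nat) :
  {morph f : x y / (x * y)%g} -> (forall x, f x \in G) ->
  (forall a, a \in G -> exists x, f x = a) ->
  prime p -> 1 <= c -> #|G| = p ^ n ->
  B \subset ('Z(G))%g -> cyclic B -> #|B| = p ^ k ->
  (exists X : {set coset_of B}, #|X| <= d /\ <<X>>%g = (G / B)%g) ->
  index_le (icomm (@full T) c) (icomm (kernel f) c)
    (p ^ (witt_chi c.+1 (n - k) + d * k * (1 + d) ^ (c - 1))).
Proof.
move=> fM fG fonto p_pr c0 oG BZ /cyclicP[z EB] oB [X [Xd genX]].
have zG : z \in G by apply: (subsetP (subset_trans BZ (center_sub G))); rewrite EB cycle_id.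
have [b fb] := fonto z zG.
have bZ : f b \in ('Z(G))%g by rewrite fb (subsetP BZ) // EB cycle_id.
have EB' : B = <[f b]>%G by apply/val_inj; rewrite fb.
move: EB' X Xd genX oB => {EB BZ} -> X Xd genX oB {B}.
pose f' x := coset <[f b]>%g (f x).
have fM' : {morph f' : x y / (x * y)%g} := quotient_mor fM fG bZ.
have fG' := @quotient_im _ _ _ _ b fG.
have fonto' := @quotient_onto _ _ _ _ b fonto.
have nf := kernel_normal fM; have nf' := kernel_normal fM'.
have p0 := prime_gt0 p_pr.
have oGB : #|(G / <[f b]>)%g| = p ^ (n - k).
  rewrite card_quotient ?normal_norm ?center_cycle_normal //.
  rewrite -divgS ?cycle_subG ?fG // oB oG expnB //.
  by rewrite -(leq_exp2l _ _ (prime_gt1 p_pr)) -oB -oG subset_leq_card // cycle_subG fG.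
(* The index of [S_c] in [gamma_{c+1}] comes from [G / B], of order [p^(n-k)]; the index of [R_c] in
   [S_c] will come from lifts of the generators of [G / B]. *)
have [_ /(_ c) cov] := pgroup_index p_pr fM' fG' fonto' oGB.
rewrite expnD; apply: index_le_trans (index_le_weaken _ cov) _.
  by rewrite leq_exp2l ?prime_gt1 // lyndon_words_witt.
case: c c0 {cov} => // c _; rewrite subn1 /=.
have lift_X : exists Y : seq T, map f' Y = enum X.
  have : {subset enum X <= (G / <[f b]>)%g}.
    by move=> x; rewrite mem_enum -genX; apply: mem_gen.
  elim: (enum X) => [|x s IH] sG; first by exists [::].
  have [y yx] := fonto' x (sG _ (mem_head _ _)).
  have [t Et] : exists Y, map f' Y = s by apply: IH => u us; rewrite sG // inE us orbT.
  by exists (y :: t); rewrite /= Et -yx.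
have [Y EY] := lift_X.
have sY : size Y = #|X| by rewrite cardE -EY size_map.
have genT' x : gen (fun y => y \in Y \/ kernel f' y) x.
  have : f' x \in <<X>>%g by rewrite genX; apply: fG'.
  set P := gen _; have [P1 PV PM] : subgroup P by apply: gen_subgroup.
  case/gen_prodgP => m [e eX fx].
  have [y Py fy] : exists2 y, P y & f' y = f' x.
    rewrite fx; elim/big_ind: _ => [|_ _ [u Pu <-] [v Pv <-]|i _].
    - by exists 1%g => //; apply: mor1.
    - by exists (u * v)%g; [apply: PM | apply: fM'].
    have : e i \in map f' Y by rewrite EY mem_enum eX.
    by case/mapP => y yY ->; exists y => //; apply: gen_in; left.
  rewrite -[x](mulKVg y); apply: (PM) => //; apply: gen_in; right.
  by rewrite /kernel fM' (morV fM') fy mulVg.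
have genT := quotient_gen_lift fM fG bZ genT'.
have := @left_normed_index_le _ _ _ nf nf' (@kernel_sub_quotient _ _ f b)
  (kernel_quotient_central fM fG bZ) (p ^ k) _ _ b Y c _ _ genT.
rewrite -expnM => H; apply: index_le_weaken (H _ _ _ _).
- rewrite leq_exp2l ?prime_gt1 // sY add1n mulnA (mulnC k).
  apply: leq_mul; first by rewrite leq_mul2r Xd orbT.
  by case: (c) => // e; rewrite leq_exp2r.
- by rewrite expn_gt0 p0.
- by move=> x /(kernel_quotient_exp fM fG bZ); rewrite /order oB.
- by apply/coset_id/cycle_id.
- exact: kernel_quotient_gen fM fG bZ.
Qed.

(** * Transversals, and splitting an index along a kernel *)

Section Transversals.
Variable T : groupType.
Implicit Types (A N : T -> Prop) (s t : seq T).
Local Open Scope group_scope.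

Definition independent N s :=
  uniq s /\ forall x y, x \in s -> y \in s -> N (x^-1 * y) -> x = y.

(** Two members of [s] in the coset of one representative are congruent modulo [N], so the choice of
    representatives is injective on [s]. *)
Lemma independent_size A N M s : subgroup N -> index_le A N M ->
  (forall x, x \in s -> A x) -> independent N s -> size s <= M.
Proof.
move=> [N1 NV NM] [t [tM At]] sA [us indep]; apply: leq_trans tM.
have [h Hh] : exists h : T -> T, forall x, x \in s -> h x \in t /\ N ((h x)^-1 * x).
  elim: s sA {us indep} => [|x s IH] sA; first by exists id.
  have [|h Hh] := IH; first by move=> y ys; apply: sA; rewrite inE ys orbT.
  have [w wt Nw] := At x (sA x (mem_head _ _)).
  exists (fun y => if y == x then w else h y) => y; rewrite inE.
  by case: eqP => [->|_ /Hh].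
rewrite -(size_map h); apply: uniq_leq_size.
  rewrite map_inj_in_uniq // => x y xs ys hxy; apply: indep => //.
  have [_ Nx] := Hh x xs; have [_ Ny] := Hh y ys.
  by have := NM _ _ (NV _ Nx) Ny; rewrite hxy invgM invgK -mulgA mulKVg.
by move=> _ /mapP[x /Hh[ht _] ->].
Qed.

Lemma independent_cons N s a : subgroup N -> independent N s ->
  (forall w, w \in s -> ~ N (w^-1 * a)) -> independent N (a :: s).
Proof.
move=> [N1 NV NM] [us indep] Na; split.
  by rewrite /= us andbT; apply/negP => /Na; apply; rewrite mulVg.
move=> x y; rewrite !inE => /orP[/eqP ->|xs] /orP[/eqP ->|ys] // Nxy.
- by case: (Na y ys); have := NV _ Nxy; rewrite invgM invgK.
- by case: (Na x xs).
- exact: indep.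
Qed.

(** An independent list that fails to cover [A] can be enlarged, and [independent_size] stops this
    at [M] members. Excluded middle decides whether a list covers [A]. *)
Lemma transversal_exists A N M : subgroup N -> index_le A N M ->
  exists s, [/\ forall x, x \in s -> A x, independent N s &
                forall a, A a -> exists2 w, w \in s & N (w^-1 * a)].
Proof.
move=> sN AM; have [N1 NV NM] := sN.
suff H m s : M - size s <= m -> (forall x, x \in s -> A x) -> independent N s ->
    exists s, [/\ forall x, x \in s -> A x, independent N s &
                forall a, A a -> exists2 w, w \in s & N (w^-1 * a)].
  by apply: (H M [::]) => //; rewrite leq_subr.
elim: m s => [|m IH] s sm sA indep;
  have [cov|ncov] := classic (forall a, A a -> exists2 w, w \in s & N (w^-1 * a));
  try (by exists s);
  have [a Aa Na] : exists2 a, A a & forall w, w \in s -> ~ N (w^-1 * a).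
1,3: apply: NNPP => H; apply: ncov => a Aa; apply: NNPP => H';
     by apply: H; exists a => // w ws Nw; apply: H'; exists w.
all: have sA' : forall x, x \in a :: s -> A x by
       move=> x; rewrite inE => /orP[/eqP ->|/sA].
all: have := independent_size sN AM sA' (independent_cons sN indep Na).
- by move: sm => /=; lia.
- move=> sM; apply: IH sA' (independent_cons sN indep Na).
  by move: sm sM => /=; lia.
Qed.

(** Products of a lift of an element of [L] and a member of [s] are incongruent modulo [N]: since
    [N] lies in the kernel, [f] recovers the lift, and then independence of [s] applies. *)
Lemma kernel_transversal (gT : finGroupType) (f : T -> gT)
    (A N : T -> Prop) (L : {set gT}) M :
  {morph f : x y / x * y} -> subgroup A -> subgroup N ->
  (forall x, N x -> kernel f x) ->
  (forall g, g \in L -> exists2 x, A x & f x = g) ->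
  index_le A N M ->
  exists s, [/\ (#|L| * size s <= M)%N,
    forall x, x \in s -> kernel f x /\ A x, independent N s &
    forall a, kernel f a -> A a -> exists2 w, w \in s & N (w^-1 * a)].
Proof.
move=> fM sA sN Nf fL AM; have [A1 AV AMul] := sA.
have AM' : index_le (fun x => kernel f x /\ A x) N M.
  by apply: index_le_sub AM => x [].
have [s [sfA indep cov]] := transversal_exists sN AM'.
exists s; split=> //; last by move=> a fa Aa; apply: cov.
have [r [Er rA]] : exists r : seq T, map f r = enum L /\ forall x, x \in r -> A x.
  have : {subset enum L <= L} by move=> x; rewrite mem_enum.
  elim: (enum L) => [|g l IH] lL; first by exists [::].
  have [|r [Er rA]] := IH; first by move=> x xl; apply: lL; rewrite inE xl orbT.
  have [x Ax fx] := fL g (lL _ (mem_head _ _)).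
  exists (x :: r); rewrite /= Er fx; split=> // y.
  by rewrite inE => /orP[/eqP ->|/rA].
have f_inj x y : x \in r -> y \in r -> f x = f y -> x = y.
  have : uniq (map f r) by rewrite Er enum_uniq.
  elim: (r) => //= z t IH /andP[zt ut]; rewrite !inE.
  move=> /orP[/eqP ->|xt] /orP[/eqP ->|yt] // E; last exact: IH.
    by case/negP: zt; rewrite E map_f.
  by case/negP: zt; rewrite -E map_f.
have [us indep_s] := indep.
have key x x' y y' : x \in r -> x' \in r -> y \in s -> y' \in s ->
    N ((x * y)^-1 * (x' * y')) -> x = x' /\ y = y'.
  move=> xr x'r ys y's Nxy.
  have [fy _] := sfA y ys; have [fy' _] := sfA y' y's.
  have Exx : x = x'.
    apply: f_inj => //; have := Nf _ Nxy.
    rewrite /kernel !(fM, morV fM) fy fy' !mulg1 => /eqP.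
    by rewrite -(inj_eq (mulgI (f x))) mulKVg mulg1 eq_sym => /eqP.
  split=> //; apply: indep_s => //; move: Nxy.
  by rewrite Exx invgM -mulgA mulKg.
have <- : size [seq x * y | x <- r, y <- s] = (#|L| * size s)%N.
  by rewrite size_allpairs cardE -Er size_map.
apply: (independent_size sN AM).
  move=> _ /allpairsP[[x y] /= [xr ys ->]]; apply: AMul; first exact: rA.
  by case: (sfA y ys).
split.
  apply: allpairs_uniq => //; first by apply: (@map_uniq _ _ f); rewrite Er enum_uniq.
  move=> _ _ /allpairsP[[x y] /= [xr ys ->]] /allpairsP[[x' y'] /= [x'r y's ->]] /= E.
  have [|-> ->//] := key x x' y y' xr x'r ys y's.
  by rewrite E mulVg; case: sN.
move=> _ _ /allpairsP[[x y] /= [xr ys ->]] /allpairsP[[x' y'] /= [x'r y's ->]] /= Nxy.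
by have [-> ->] := key x x' y y' xr x'r ys y's Nxy.
Qed.
End Transversals.

(** * Multiplication of reduced words *)

Section ReducedWords.
Implicit Types (x y : letter) (u v w : word).

Lemma linvK : involutive linv.
Proof. by case=> i s; rewrite /linv /= negbK. Qed.

Lemma reduced_sorted w : reduced w = sorted (fun x y => y != linv x) w.
Proof. by elim: w => //= x [|y w] //= ->. Qed.

Lemma wpush_reduced x w : reduced w -> reduced (wpush x w).
Proof.
case: w => [|y w] //=; case: ifP => [_|yx] /andP[Hy rw] //=.
by rewrite yx Hy.
Qed.

Lemma wmul_reduced u v : reduced v -> reduced (wmul u v).
Proof. by move=> rv; elim: u => //= x u; apply: wpush_reduced. Qed.

(** Letters therefore act as permutations of the reduced words, which makes multiplication by
    successive pushes associative. *)
Lemma wpushK x w : reduced w -> wpush x (wpush (linv x) w) = w.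
Proof.
case: w => [|y w] /=; first by rewrite eqxx.
rewrite linvK; have [->|yx] := eqVneq y x; last by rewrite /= eqxx.
by case: w => //= z w /andP[/negPf ->].
Qed.

Lemma wmul_wpush x v w : reduced w -> wmul (wpush x v) w = wpush x (wmul v w).
Proof.
move=> rw; case: v => //= y v; case: eqP => [->|_] //=.
by rewrite wpushK // wmul_reduced.
Qed.

Lemma wmulA u v w : reduced w -> wmul u (wmul v w) = wmul (wmul u v) w.
Proof. by move=> rw; elim: u => //= x u ->; rewrite wmul_wpush. Qed.

Lemma wmul1 v : reduced v -> wmul v wone = v.
Proof.
elim: v => //= x v IH /andP[xv /IH ->].
by case: v xv {IH} => //= y v /negPf ->.
Qed.

Lemma wmulVw v : wmul (winv v) v = wone.
Proof.
by elim: v => //= x v IH; rewrite /winv /= rev_cons /wmul foldr_rcons /= linvK eqxx.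
Qed.

Lemma winvK : involutive winv.
Proof.
by move=> v; rewrite /winv map_rev revK -map_comp map_id_in // => x _; apply: linvK.
Qed.

Lemma wmulwV v : wmul v (winv v) = wone.
Proof. by rewrite -{1}(winvK v) wmulVw. Qed.

Lemma winv_reduced v : reduced v -> reduced (winv v).
Proof.
rewrite !reduced_sorted rev_sorted sorted_map; apply: sub_sorted => x y /=.
by rewrite linvK eq_sym.
Qed.

End ReducedWords.

(** Transports subgroups of words to a type carrying the group structure, where the commutator
    calculus applies. *)
Local Notation represents U V :=
  (forall w : word, U w <-> exists2 x, V x & val x = w) (only parsing).

(** * The free group on reduced words *)

Section FreeGroup.
Variable r : nat.

Definition free_word w := reduced w && all (fun x : letter => x.1 < r) w.

Lemma free_wordP w : reflect (freeF r w) (free_word w).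
Proof. exact: andP. Qed.

Record free_group := FreeGroup { free_val :> word; free_valP : free_word free_val }.

HB.instance Definition _ := [isSub for free_val].
HB.instance Definition _ := [Choice of free_group by <:].

Lemma free_reduced (u : free_group) : reduced u.
Proof. by case/andP: (free_valP u). Qed.

Fact free_one_subproof : free_word wone. Proof. by []. Qed.

Fact free_mul_subproof (u v : free_group) : free_word (wmul u v).
Proof.
case/andP: (free_valP u) (free_valP v) => _ + /andP[rv]; rewrite /free_word wmul_reduced //=.
move: (val u) (val v) {rv} => a b; elim: a => //= x a IH /andP[xr ar] br.
have := IH ar br; case: (wmul a b) => [|y w] /=; first by rewrite xr.
by case: ifP => _ /andP[yr wr] //=; rewrite xr yr.
Qed.

Fact free_inv_subproof (u : free_group) : free_word (winv u).
Proof.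
case/andP: (free_valP u) => ru ur; rewrite /free_word winv_reduced //=.
by rewrite all_rev all_map.
Qed.

Definition free_one := FreeGroup free_one_subproof.
Definition free_mul u v := FreeGroup (free_mul_subproof u v).
Definition free_inv u := FreeGroup (free_inv_subproof u).

Fact free_mulA : associative free_mul.
Proof. by move=> u v w; apply/val_inj/wmulA/free_reduced. Qed.
Fact free_mul1 : left_id free_one free_mul.
Proof. by move=> u; apply/val_inj. Qed.
Fact free_mulr1 : right_id free_one free_mul.
Proof. by move=> u; apply/val_inj/wmul1/free_reduced. Qed.
Fact free_mulV : left_inverse free_one free_inv free_mul.
Proof. by move=> u; apply/val_inj/wmulVw. Qed.
Fact free_mulrV : right_inverse free_one free_inv free_mul.
Proof. by move=> u; apply/val_inj/wmulwV. Qed.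

HB.instance Definition _ := isGroup.Build free_group
  free_mulA free_mul1 free_mulr1 free_mulV free_mulrV.


Lemma represents_val (U : word -> Prop) (V : free_group -> Prop) x : represents U V -> U (val x) <-> V x.
Proof.
move=> UV; split=> [Ux|Vx]; last by apply/UV; exists x.
by case/UV: Ux => y Vy /val_inj <-.
Qed.

Lemma represents_free : represents (freeF r) (@full free_group).
Proof.
move=> w; split=> [/free_wordP wr|[x _ <-]]; first by exists (FreeGroup wr).
exact/free_wordP/free_valP.
Qed.

Lemma represents_gen (U : word -> Prop) (V : free_group -> Prop) : represents U V -> represents (wgen U) (gen V).
Proof.
move=> UV w; split.
  elim=> {w} [|w /UV[x Vx <-]|_ _ [x Vx <-]|_ _ _ [x Vx <-] _ [y Vy <-]].
  - by exists 1%g => //; apply: gen_one.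
  - by exists x => //; apply: gen_in.
  - by exists x^-1%g => //; case: (gen_subgroup V) => _ GV _; apply: GV.
  - by exists (x * y)%g => //; apply: gen_mul.
move=> [x + <-] {w}; elim=> {x} [|x Vx|x Vx|x y _ IHx _ IHy].
- exact: wgen_one.
- by apply: wgen_in; apply/UV; exists x.
- by apply/wgen_inv/wgen_in/UV; exists x.
- exact: wgen_mul.
Qed.

Lemma represents_comm (U U' : word -> Prop) (V V' : free_group -> Prop) : represents U V -> represents U' V' ->
  represents (wcommsub U U') (comms V V').
Proof.
move=> UV UV'; apply: represents_gen => w; split.
  move=> [_ [_ [/UV[x Vx <-] [/UV'[y Vy <-] ->]]]].
  by exists [~ x, y]%g => //; exists x, y.
move=> [_ [x [y [Vx [Vy ->]]]] <-]; exists (val x), (val y).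
by split; [apply/UV; exists x | split=> //; apply/UV'; exists y].
Qed.

Lemma represents_icomm (U : word -> Prop) (V : free_group -> Prop) c : represents U V ->
  represents (witcomm U (freeF r) c) (icomm V c).
Proof.
by move=> UV; elim: c => //= c IH; apply: represents_comm => //; apply: represents_free.
Qed.

Lemma represents_gamma c : represents (wgamma r c.+1) (icomm (@full free_group) c).
Proof.
elim: c => [|c IH]; first exact: represents_free.
by apply: represents_comm => //; apply: represents_free.
Qed.

End FreeGroup.

(** * Evaluation of words at the generators of [G] *)

Section Evaluation.
Variables (gT : finGroupType) (G : {group gT}) (gens : seq gT).
Hypothesis presG : presents G gens.
Local Open Scope group_scope.

Let ev (w : free_group (size gens)) : gT := weval gens (val w).

Lemma eval_linv x : eval_letter gens (linv x) = (eval_letter gens x)^-1.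
Proof. by case: x => i [] //=; rewrite /eval_letter /= invgK. Qed.

Lemma weval_wpush x w : weval gens (wpush x w) = eval_letter gens x * weval gens w.
Proof.
case: w => [|y w]; rewrite /weval /= ?big_seq1 ?big_nil ?mulg1 //.
case: eqP => [->|_]; rewrite !big_cons //.
by rewrite eval_linv mulKVg.
Qed.

Lemma weval_mor : {morph ev : x y / x * y}.
Proof.
move=> u v; rewrite /ev -[val (u * v)]/(wmul (val u) (val v)).
elim: (val u) => [|x w IH] /=; first by rewrite /weval big_nil mul1g.
by rewrite weval_wpush IH /weval big_cons mulgA.
Qed.

Lemma weval_in x : ev x \in G.
Proof.
have [gG _] := presG; rewrite /ev /weval; apply: group_prod => -[i s] _.
suff gi : nth 1 gens i \in G by rewrite /eval_letter; case: s; rewrite ?groupV.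
by have [ig|ig] := ltnP i (size gens); [apply/gG/mem_nth | rewrite nth_default].
Qed.

Lemma weval_onto a : a \in G -> exists x, ev x = a.
Proof.
have [_ <-] := presG => /gen_prodgP[n [e eP ->]].
elim/big_ind: _ => [|_ _ [x <-] [y <-]|i _].
- by exists 1; apply: mor1 weval_mor.
- by exists (x * y); apply: weval_mor.
have := eP i; rewrite inE => ei.
have wr : free_word (size gens) [:: (index (e i) gens, false)].
  by rewrite /free_word /= index_mem ei.
by exists (FreeGroup wr); rewrite /ev /weval big_seq1 /eval_letter /= nth_index.
Qed.

Lemma represents_relsub : represents (relsub gens) (kernel ev).
Proof.
move=> w; split=> [[/represents_free[x _ <-] wx]|[x kx <-]]; first by exists x.
by split=> //; apply/represents_free; exists x.
Qed.

End Evaluation.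

Theorem theoremA (gT : finGroupType) (G B : {group gT}) (p n c k d : nat) :
  prime p -> 1 <= c -> #|G| = p ^ n ->
  B \subset ('Z(G))%g -> cyclic B -> #|B| = p ^ k -> exponent ('Z(G))%g = p ^ k ->
  (exists X : {set coset_of B}, #|X| <= d /\ <<X>>%g = (G / B)%g) ->
  forall gens : seq gT, presents G gens ->
  exists m : nat, cmult_order gens c m /\
    #|('L_c.+1(G))%g| * m <= p ^ (witt_chi c.+1 (n - k) + d * k * (1 + d) ^ (c - 1)).
Proof.
move=> p_pr c0 oG BZ cB oB _ HX gens presG.
have fM := @weval_mor _ gens; have fG := weval_in presG; have fonto := weval_onto presG.
have bound := gamma_index_bound fM fG fonto p_pr c0 oG BZ cB oB HX.
have nK := kernel_normal fM.
have [sA _] := icomm_normal c (@normalsub_full (free_group (size gens))).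
have [sN _] := icomm_normal c nK.
have Nf (x : free_group (size gens)) :
    icomm (kernel (fun w : free_group (size gens) => weval gens (val w))) c x ->
    weval gens (val x) = 1%g.
  by elim: c {c0 bound sA sN} x => // i IH x /(icomm_sub nK)/IH.
(* Here [L] is [gamma_{c+1}(G)], and [s] is a transversal of [[R,_c F]] in the intersection of [R]
   and [gamma_{c+1}(F)], so [size s] is the order of the multiplier. *)
have [s [sM sfA [us indep] cov]] := kernel_transversal fM sA sN Nf (lcn_lift fM fonto) bound.
have repA w := represents_gamma (size gens) c w.
have repN := represents_icomm c (represents_relsub gens).
exists (size s); split=> //; exists (map val s); split.
- by rewrite size_map.
- move=> _ /mapP[x /sfA[fx Ax] ->]; split; last by apply/repA; exists x.
  by apply/represents_relsub; exists x.
- move=> i j /andP[ij jm]; have im := ltn_trans ij jm.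
  rewrite !(nth_map 1%g) //.
  move=> /(represents_val ((nth 1%g s i)^-1 * nth 1%g s j)%g repN).
  move=> /indep E; have /eqP := E (mem_nth _ im) (mem_nth _ jm).
  by rewrite nth_uniq // ltn_eqF.
- move=> a [/represents_relsub[x fx <-] /repA[y Ay /val_inj Eyx]].
  rewrite Eyx in Ay; have [w ws Nw] := cov x fx Ay.
  exists (val w); first exact: map_f.
  exact/(represents_val (w^-1 * x)%g repN).
Qed.
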